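(* Let $(S,\mathfrak n)$ be a commutative noetherian local ring and let $\omega\in\mathfrak n$ be a non-zerodivisor. Then $\mathsf{MF}(\omega,\mathcal P)$ is a Frobenius subcategory of $\mathsf{MF}(\omega,\mathcal G)$, with the same projective objects. In particular, there is a fully faithful triangle functor $\underline{\mathsf{MF}}(\omega,\mathcal P)\longrightarrow\underline{\mathsf{MF}}(\omega,\mathcal G)$.
   Context: All modules are finitely generated. $\mathcal P(S)$ is the category of finitely generated projective $S$-modules. A finitely generated $S$-module $M$ is Gorenstein projective if $\mathrm{Ext}^i_S(M,S)=0=\mathrm{Ext}^i_S(\mathrm{Hom}_S(M,S),S)$ for all $i\ge 1$ and the biduality map $M\to \mathrm{Hom}_S(\mathrm{Hom}_S(M,S),S)$ is an isomorphism; $\mathcal G(S)$ is the category of finitely generated Gorenstein projective $S$-modules. $\mathsf{MF}(\omega,\mathcal G)$ is the category whose objects are ordered pairs of $S$-homomorphisms $(G_1\xrightarrow{g_1}G_0,\ G_0\xrightarrow{g_0}G_1)$ with $G_1,G_0\in\mathcal G(S)$, $g_1g_0=\omega\cdot\mathrm{id}_{G_0}$ and $g_0g_1=\omega\cdot\mathrm{id}_{G_1}$; morphisms $(g_1,g_0)\to(g_1',g_0')$ are pairs of $S$-homomorphisms $\phi_1:G_1\to G_1'$, $\phi_0:G_0\to G_0'$ with $g_1'\phi_1=\phi_0g_1$ and $g_0'\phi_0=\phi_1g_0$. $\mathsf{MF}(\omega,\mathcal P)$ is its full subcategory of objects with $G_1,G_0\in\mathcal P(S)$. Conflations in each are the componentwise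 short exact sequences with all terms in the category; with these, $\mathsf{MF}(\omega,\mathcal G)$ is a Frobenius category, i.e. an exact category with enough projectives and enough injectives in which projectives and injectives coincide. ''Frobenius subcategory'' means an extension-closed full subcategory which, with the inherited exact structure, is itself a Frobenius category. The stable category $\underline{\mathcal F}$ of a Frobenius category $\mathcal F$ has the same objects, with morphisms taken modulo those factoring through projective objects; it carries Happel's triangulated structure, with shift the inverse syzygy and distinguished triangles induced by conflations. A triangle functor is an additive functor commuting with shifts up to natural isomorphism and preserving distinguished triangles. *)

(* Defs.v *)
From HB Require Import structures.
From mathcomp Require Import all_boot all_order all_algebra ring_quotient.
From mathcomp Require Import boolp functions.

Set Implicit Arguments.
Unset Strict Implicit.
Unset Printing Implicit Defensive.

Import GRing.Theory.
Local Open Scope ring_scope.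
Local Open Scope quotient_scope.

Reserved Notation "g \oc f" (at level 45, left associativity).

Record preadditive := Preadditive {
  obj :> Type;
  hom : obj -> obj -> zmodType;
  idm : forall X : obj, hom X X;
  compm : forall X Y Z : obj, hom Y Z -> hom X Y -> hom X Z;
  compmA : forall (X Y Z T : obj) (h : hom Z T) (g : hom Y Z) (f : hom X Y),
    compm h (compm g f) = compm (compm h g) f;
  comp1m : forall (X Y : obj) (f : hom X Y), compm (idm Y) f = f;
  compm1 : forall (X Y : obj) (f : hom X Y), compm f (idm X) = f;
  compmDl : forall (X Y Z : obj) (g h : hom Y Z) (f : hom X Y),
    compm (g + h) f = compm g f + compm h f;
  compmDr : forall (X Y Z : obj) (h : hom Y Z) (f g : hom X Y),
    compm h (f + g) = compm h f + compm h g }.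

Arguments hom {p} X Y.
Arguments idm {p} X.
Arguments compm {p X Y Z} g f.
Notation "g \oc f" := (compm g f).

Section PreadditiveTheory.
Variable C : preadditive.

Lemma compm0l (X Y Z : C) (f : hom X Y) : (0 : hom Y Z) \oc f = 0.
Proof. by apply: (addrI (0 \oc f)); rewrite -compmDl !addr0. Qed.

Lemma compm0r (X Y Z : C) (g : hom Y Z) : g \oc (0 : hom X Y) = 0.
Proof. by apply: (addrI (g \oc 0)); rewrite -compmDr !addr0. Qed.

Lemma compmNl (X Y Z : C) (g : hom Y Z) (f : hom X Y) : (- g) \oc f = - (g \oc f).
Proof. by apply: (addrI (g \oc f)); rewrite -compmDl !subrr compm0l. Qed.

Lemma compmNr (X Y Z : C) (g : hom Y Z) (f : hom X Y) : g \oc (- f) = - (g \oc f).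
Proof. by apply: (addrI (g \oc f)); rewrite -compmDr !subrr compm0r. Qed.

Lemma compmBl (X Y Z : C) (g h : hom Y Z) (f : hom X Y) :
  (g - h) \oc f = g \oc f - h \oc f.
Proof. by rewrite compmDl compmNl. Qed.

Lemma compmBr (X Y Z : C) (h : hom Y Z) (f g : hom X Y) :
  h \oc (f - g) = h \oc f - h \oc g.
Proof. by rewrite compmDr compmNr. Qed.

Definition is_iso (X Y : C) (f : hom X Y) : Prop :=
  exists g : hom Y X, g \oc f = idm X /\ f \oc g = idm Y.

Definition is_kernel (X Y Z : C) (i : hom X Y) (p : hom Y Z) : Prop :=
  p \oc i = 0 /\
  forall (T : C) (f : hom T Y), p \oc f = 0 -> exists! g : hom T X, i \oc g = f.

Definition is_cokernel (X Y Z : C) (i : hom X Y) (p : hom Y Z) : Prop :=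
  p \oc i = 0 /\
  forall (T : C) (f : hom Y T), f \oc i = 0 -> exists! g : hom Z T, g \oc p = f.

Definition is_pushout (X Y X' Y' : C) (i : hom X Y) (f : hom X X')
    (i' : hom X' Y') (f' : hom Y Y') : Prop :=
  i' \oc f = f' \oc i /\
  forall (T : C) (a : hom X' T) (b : hom Y T), a \oc f = b \oc i ->
    exists! c : hom Y' T, c \oc i' = a /\ c \oc f' = b.

Definition is_pullback (Y Z Y' Z' : C) (p : hom Y Z) (f : hom Z' Z)
    (p' : hom Y' Z') (f' : hom Y' Y) : Prop :=
  f \oc p' = p \oc f' /\
  forall (T : C) (a : hom T Z') (b : hom T Y), f \oc a = p \oc b ->
    exists! c : hom T Y', p' \oc c = a /\ f' \oc c = b.

Definition is_biproduct (X Y B : C) (i1 : hom X B) (i2 : hom Y B)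
    (p1 : hom B X) (p2 : hom B Y) : Prop :=
  [/\ p1 \oc i1 = idm X, p2 \oc i2 = idm Y, p1 \oc i2 = 0, p2 \oc i1 = 0
    & i1 \oc p1 + i2 \oc p2 = idm B].

Record is_additive : Prop := IsAdditive {
  has_zero : exists Z : C, idm Z = 0;
  has_biproducts : forall X Y : C, exists (B : C) (i1 : hom X B) (i2 : hom Y B)
    (p1 : hom B X) (p2 : hom B Y), is_biproduct i1 i2 p1 p2 }.

End PreadditiveTheory.

(* A preadditive category with a class of composable pairs; [is_exact] says
   that this class is an exact structure. *)
Record exact_data := ExactData {
  ecat :> preadditive;
  confl : forall X Y Z : ecat, hom X Y -> hom Y Z -> Prop }.

Section ExactCategories.
Variable E : exact_data.

Definition inflation (X Y : E) (i : hom X Y) : Prop :=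
  exists (Z : E) (p : hom Y Z), confl i p.

Definition deflation (Y Z : E) (p : hom Y Z) : Prop :=
  exists (X : E) (i : hom X Y), confl i p.

(* Quillen's axioms, in Buehler's formulation. *)
Record is_exact : Prop := IsExact {
  exact_additive : is_additive E;
  confl_kernel : forall (X Y Z : E) (i : hom X Y) (p : hom Y Z),
    confl i p -> is_kernel i p;
  confl_cokernel : forall (X Y Z : E) (i : hom X Y) (p : hom Y Z),
    confl i p -> is_cokernel i p;
  confl_iso : forall (X Y Z X' Y' Z' : E) (i : hom X Y) (p : hom Y Z)
      (i' : hom X' Y') (p' : hom Y' Z') (a : hom X X') (b : hom Y Y') (c : hom Z Z'),
    is_iso a -> is_iso b -> is_iso c -> i' \oc a = b \oc i -> p' \oc b = c \oc p ->
    confl i p -> confl i' p';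
  inflation_id : forall X : E, inflation (idm X);
  deflation_id : forall X : E, deflation (idm X);
  inflation_comp : forall (X Y Z : E) (j : hom Y Z) (i : hom X Y),
    inflation j -> inflation i -> inflation (j \oc i);
  deflation_comp : forall (X Y Z : E) (q : hom Y Z) (p : hom X Y),
    deflation q -> deflation p -> deflation (q \oc p);
  inflation_pushout : forall (X Y X' : E) (i : hom X Y) (f : hom X X'),
    inflation i -> exists (Y' : E) (i' : hom X' Y') (f' : hom Y Y'),
      is_pushout i f i' f' /\ inflation i';
  deflation_pullback : forall (Y Z Z' : E) (p : hom Y Z) (f : hom Z' Z),
    deflation p -> exists (Y' : E) (p' : hom Y' Z') (f' : hom Y' Y),
      is_pullback p f p' f' /\ deflation p' }.

Definition projective_obj (P : E) : Prop :=
  forall (Y Z : E) (p : hom Y Z) (f : hom P Z),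
    deflation p -> exists g : hom P Y, p \oc g = f.

Definition injective_obj (I : E) : Prop :=
  forall (X Y : E) (i : hom X Y) (f : hom X I),
    inflation i -> exists g : hom Y I, g \oc i = f.

Record is_frobenius : Prop := IsFrobenius {
  frobenius_exact : is_exact;
  enough_projectives : forall X : E, exists (P : E) (p : hom P X),
    projective_obj P /\ deflation p;
  enough_injectives : forall X : E, exists (I : E) (i : hom X I),
    injective_obj I /\ inflation i;
  projective_injective : forall X : E, projective_obj X <-> injective_obj X }.

End ExactCategories.

Section FullSubcategory.
Variables (E : exact_data) (D : E -> Prop).

Definition full_preadditive : preadditive :=
  @Preadditive {X : E | D X} (fun X Y => hom (sval X) (sval Y))
    (fun X => idm (sval X)) (fun X Y Z g f => g \oc f)
    (fun X Y Z T => @compmA E (sval X) (sval Y) (sval Z) (sval T))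
    (fun X Y => @comp1m E (sval X) (sval Y))
    (fun X Y => @compm1 E (sval X) (sval Y))
    (fun X Y Z => @compmDl E (sval X) (sval Y) (sval Z))
    (fun X Y Z => @compmDr E (sval X) (sval Y) (sval Z)).

Definition full_subcategory : exact_data :=
  @ExactData full_preadditive
    (fun (X Y Z : full_preadditive) (i : hom X Y) (p : hom Y Z) =>
       @confl E (sval X) (sval Y) (sval Z) i p).

Definition extension_closed : Prop :=
  forall (X Y Z : E) (i : hom X Y) (p : hom Y Z), confl i p -> D X -> D Z -> D Y.

Record is_frobenius_subcategory : Prop := IsFrobeniusSubcategory {
  frobenius_sub_ext : extension_closed;
  frobenius_sub_frobenius : is_frobenius full_subcategory }.

Definition same_projectives : Prop :=
  forall X : E, projective_obj X <->
    exists DX : D X, @projective_obj full_subcategory (exist D X DX).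

End FullSubcategory.

Record additive_functor (C D : preadditive) := AdditiveFunctor {
  fobj :> C -> D;
  fmap : forall X Y : C, hom X Y -> hom (fobj X) (fobj Y);
  fmap_id : forall X : C, fmap (idm X) = idm (fobj X);
  fmap_comp : forall (X Y Z : C) (g : hom Y Z) (f : hom X Y),
    fmap (g \oc f) = fmap g \oc fmap f;
  fmapD : forall (X Y : C) (f g : hom X Y), fmap (f + g) = fmap f + fmap g }.

Arguments fmap {C D} F {X Y} f : rename.

Definition fully_faithful (C D : preadditive) (F : additive_functor C D) : Prop :=
  forall X Y : C, bijective (fun f : hom X Y => fmap F f).

(* Only the data of a triangulated category: a shift and a class of
   distinguished triangles X -u-> Y -v-> Z -w-> shift X. *)
Record triangulation_data := TriangulationData {
  tcat :> preadditive;
  shift : additive_functor tcat tcat;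
  distinguished : forall X Y Z : tcat,
    hom X Y -> hom Y Z -> hom Z (shift X) -> Prop }.

Definition triangle_functor (T U : triangulation_data)
    (F : additive_functor T U) : Prop :=
  exists eta : forall X : T, hom (F (shift T X)) (shift U (F X)),
    [/\ forall X : T, is_iso (eta X),
        forall (X Y : T) (f : hom X Y),
          eta Y \oc fmap F (fmap (shift T) f) = fmap (shift U) (fmap F f) \oc eta X
      & forall (X Y Z : T) (u : hom X Y) (v : hom Y Z) (w : hom Z (shift T X)),
          distinguished u v w ->
          distinguished (fmap F u) (fmap F v) (eta X \oc fmap F w)].

Definition factors_projective (E : exact_data) (X Y : E) (f : hom X Y) : Prop :=
  exists (P : E) (b : hom P Y) (a : hom X P), projective_obj P /\ f = b \oc a.

Section Stable.
Variables (E : exact_data) (HE : is_frobenius E).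

Let addE : is_additive E := exact_additive (frobenius_exact HE).

Lemma factors_projective0 (X Y : E) : factors_projective (0 : hom X Y).
Proof.
have [P [p [Pproj _]]] := enough_projectives HE Y.
by exists P, p, 0; rewrite compm0r.
Qed.

Lemma factors_projectiveN (X Y : E) (f : hom X Y) :
  factors_projective f -> factors_projective (- f).
Proof. by move=> [P [b [a [PP ->]]]]; exists P, b, (- a); rewrite compmNr. Qed.

Lemma projective_biproduct (P Q B : E) (i1 : hom P B) (i2 : hom Q B)
    (p1 : hom B P) (p2 : hom B Q) :
  is_biproduct i1 i2 p1 p2 -> projective_obj P -> projective_obj Q ->
  projective_obj B.
Proof.
move=> [_ _ _ _ e] PP PQ Y Z p f dp.
have [g1 e1] := PP _ _ p (f \oc i1) dp.
have [g2 e2] := PQ _ _ p (f \oc i2) dp.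
exists (g1 \oc p1 + g2 \oc p2).
by rewrite compmDr !compmA e1 e2 -!compmA -compmDr e compm1.
Qed.

Lemma factors_projectiveD (X Y : E) (f g : hom X Y) :
  factors_projective f -> factors_projective g -> factors_projective (f + g).
Proof.
move=> [P [b [a [PP ->]]]] [Q [d [c [PQ ->]]]].
have [B [i1 [i2 [p1 [p2 bi]]]]] := has_biproducts addE P Q.
have PB := projective_biproduct bi PP PQ.
case: bi => e1 e2 e12 e21 _.
exists B, (b \oc p1 + d \oc p2), (i1 \oc a + i2 \oc c); split=> //.
rewrite compmDl !compmDr.
rewrite -!(compmA b) -!(compmA d) !(compmA p1) !(compmA p2) e1 e2 e12 e21.
by rewrite !comp1m !compm0l !compm0r addr0 add0r.
Qed.

Definition null_pred (X Y : E) : {pred hom X Y} :=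
  fun f => `[< factors_projective f >].

Lemma null_zmod_closed (X Y : E) : zmod_closed (@null_pred X Y).
Proof.
split; first by apply/asboolP; exact: factors_projective0.
move=> f g /asboolP Nf /asboolP Ng; apply/asboolP.
exact: factors_projectiveD Nf (factors_projectiveN Ng).
Qed.

Definition null_zmod (X Y : E) : zmodClosed (hom X Y) :=
  HB.pack (@null_pred X Y) (GRing.isZmodClosed.Build _ _ (@null_zmod_closed X Y)).

Definition stable_hom (X Y : E) : zmodType := Quotient.quot (null_zmod X Y).

Definition stable_class (X Y : E) (f : hom X Y) : stable_hom X Y := \pi f.

Lemma stable_classP (X Y : E) (f g : hom X Y) :
  stable_class f = stable_class g <-> factors_projective (f - g).
Proof.
rewrite /stable_class; split=> [/eqP|fg].
  by rewrite -Quotient.idealrBE => /asboolP.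
by apply/eqP; rewrite -Quotient.idealrBE; apply/asboolP.
Qed.

Lemma stable_classD (X Y : E) (f g : hom X Y) :
  stable_class (f + g) = stable_class f + stable_class g.
Proof. exact: raddfD. Qed.

Lemma stable_classK (X Y : E) (f : stable_hom X Y) : stable_class (repr f) = f.
Proof. exact: reprK. Qed.

Definition stable_comp (X Y Z : E) (g : stable_hom Y Z) (f : stable_hom X Y) :
  stable_hom X Z := stable_class (repr g \oc repr f).

Lemma stable_classM (X Y Z : E) (g : hom Y Z) (f : hom X Y) :
  stable_comp (stable_class g) (stable_class f) = stable_class (g \oc f).
Proof.
rewrite /stable_comp; set g' := repr _; set f' := repr _.
have /stable_classP [P [b [a [PP e]]]] : stable_class g' = stable_class g.
  exact: stable_classK.
have /stable_classP [Q [d [c [PQ e']]]] : stable_class f' = stable_class f.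
  exact: stable_classK.
apply/stable_classP.
have -> : g' \oc f' - g \oc f = (g' - g) \oc f' + g \oc (f' - f).
  by rewrite compmBl compmBr addrA subrK.
rewrite e e'; apply: factors_projectiveD.
  by exists P, b, (a \oc f'); rewrite compmA.
by exists Q, (g \oc d), c; rewrite compmA.
Qed.

Fact stable_compA (X Y Z T : E) (h : stable_hom Z T) (g : stable_hom Y Z)
    (f : stable_hom X Y) :
  stable_comp h (stable_comp g f) = stable_comp (stable_comp h g) f.
Proof.
rewrite -(stable_classK h) -(stable_classK g) -(stable_classK f).
by rewrite !stable_classM compmA.
Qed.

Fact stable_comp1m (X Y : E) (f : stable_hom X Y) :
  stable_comp (stable_class (idm Y)) f = f.
Proof. by rewrite -(stable_classK f) stable_classM comp1m. Qed.

Fact stable_compm1 (X Y : E) (f : stable_hom X Y) :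
  stable_comp f (stable_class (idm X)) = f.
Proof. by rewrite -(stable_classK f) stable_classM compm1. Qed.

Fact stable_compDl (X Y Z : E) (g h : stable_hom Y Z) (f : stable_hom X Y) :
  stable_comp (g + h) f = stable_comp g f + stable_comp h f.
Proof.
rewrite -(stable_classK g) -(stable_classK h) -(stable_classK f).
by rewrite -stable_classD !stable_classM compmDl stable_classD.
Qed.

Fact stable_compDr (X Y Z : E) (h : stable_hom Y Z) (f g : stable_hom X Y) :
  stable_comp h (f + g) = stable_comp h f + stable_comp h g.
Proof.
rewrite -(stable_classK g) -(stable_classK h) -(stable_classK f).
by rewrite -stable_classD !stable_classM compmDr stable_classD.
Qed.

Definition stable_preadditive : preadditive :=
  @Preadditive E stable_hom (fun X => stable_class (idm X)) stable_comp
    stable_compA stable_comp1m stable_compm1 stable_compDl stable_compDr.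

Record cosyzygy (X : E) := Cosyzygy {
  cosyz_inj : E;
  cosyz_obj : E;
  cosyz_i : hom X cosyz_inj;
  cosyz_p : hom cosyz_inj cosyz_obj;
  cosyz_injective : injective_obj cosyz_inj;
  cosyz_confl : confl cosyz_i cosyz_p }.

Lemma cosyzygy_exists (X : E) : exists _ : cosyzygy X, True.
Proof.
have [I [i [injI [Z [p ip]]]]] := enough_injectives HE X.
by exists (Cosyzygy injI ip).
Qed.

Definition cosyzygy_of (X : E) : cosyzygy X := sval (cid (cosyzygy_exists X)).
Definition cosyzI (X : E) : E := cosyz_inj (cosyzygy_of X).
Definition Sigma (X : E) : E := cosyz_obj (cosyzygy_of X).
Definition iota (X : E) : hom X (cosyzI X) := cosyz_i (cosyzygy_of X).
Definition piS (X : E) : hom (cosyzI X) (Sigma X) := cosyz_p (cosyzygy_of X).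

Lemma cosyzI_injective (X : E) : injective_obj (cosyzI X).
Proof. exact: cosyz_injective. Qed.

Lemma iota_piS (X : E) : confl (iota X) (piS X).
Proof. exact: cosyz_confl. Qed.

Definition Sigma_rel (X Y : E) (f : hom X Y) (g : hom (Sigma X) (Sigma Y)) : Prop :=
  exists e : hom (cosyzI X) (cosyzI Y),
    e \oc iota X = iota Y \oc f /\ g \oc piS X = piS Y \oc e.

Lemma Sigma_rel_exists (X Y : E) (f : hom X Y) :
  exists g : hom (Sigma X) (Sigma Y), Sigma_rel f g.
Proof.
have infX : inflation (iota X) by exists (Sigma X), (piS X); exact: iota_piS.
have [e ee] := cosyzI_injective (iota Y \oc f) infX.
have [piY _] := confl_kernel (frobenius_exact HE) (iota_piS Y).
have [_ cX] := confl_cokernel (frobenius_exact HE) (iota_piS X).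
have [|g [eg _]] := cX _ (piS Y \oc e).
  by rewrite -compmA ee compmA piY compm0l.
by exists g, e.
Qed.

Lemma Sigma_relD (X Y : E) (f f' : hom X Y) g g' :
  Sigma_rel f g -> Sigma_rel f' g' -> Sigma_rel (f + f') (g + g').
Proof.
move=> [e [e1 e2]] [e' [e1' e2']]; exists (e + e').
by rewrite !compmDl !compmDr e1 e2 e1' e2'.
Qed.

Lemma Sigma_relN (X Y : E) (f : hom X Y) g : Sigma_rel f g -> Sigma_rel (- f) (- g).
Proof. by move=> [e [e1 e2]]; exists (- e); rewrite !compmNl !compmNr e1 e2. Qed.

Lemma Sigma_relM (X Y Z : E) (f : hom X Y) (f' : hom Y Z) g g' :
  Sigma_rel f g -> Sigma_rel f' g' -> Sigma_rel (f' \oc f) (g' \oc g).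
Proof.
move=> [e [e1 e2]] [e' [e1' e2']]; exists (e' \oc e); split.
  by rewrite -compmA e1 !compmA e1'.
by rewrite -compmA e2 !compmA e2'.
Qed.

Lemma Sigma_rel1 (X : E) : Sigma_rel (idm X) (idm (Sigma X)).
Proof. by exists (idm (cosyzI X)); rewrite !comp1m !compm1. Qed.

Lemma Sigma_rel_null (X Y : E) (f : hom X Y) g :
  Sigma_rel f g -> factors_projective f -> factors_projective g.
Proof.
move=> [e [e1 e2]] [P [b [a [/(projective_injective HE) PI ef]]]].
have infX : inflation (iota X) by exists (Sigma X), (piS X); exact: iota_piS.
have [a' ea'] := PI _ _ _ a infX.
have [pi0 _] := confl_kernel (frobenius_exact HE) (iota_piS Y).
have [_ cX] := confl_cokernel (frobenius_exact HE) (iota_piS X).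
have [|k [ek _]] := cX _ (e - iota Y \oc b \oc a').
  by rewrite compmBl e1 ef -!compmA ea' subrr.
exists (cosyzI Y), (piS Y), k; split.
  by apply/(projective_injective HE); exact: cosyzI_injective.
have [|h [_ uh]] := cX _ (g \oc piS X).
  have [piX _] := confl_kernel (frobenius_exact HE) (iota_piS X).
  by rewrite -compmA piX compm0r.
rewrite -(uh g) //; apply: uh.
by rewrite -compmA ek compmBr !compmA pi0 !compm0l subr0 e2.
Qed.

Definition Sigma_map (X Y : E) (f : stable_hom X Y) : stable_hom (Sigma X) (Sigma Y) :=
  stable_class (sval (cid (Sigma_rel_exists (repr f)))).

Lemma Sigma_mapE (X Y : E) (f : hom X Y) (g : hom (Sigma X) (Sigma Y)) :
  Sigma_rel f g -> Sigma_map (stable_class f) = stable_class g.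
Proof.
rewrite /Sigma_map; case: cid => g' /= fg' fg; apply/stable_classP.
apply: (Sigma_rel_null (Sigma_relD fg' (Sigma_relN fg))).
by apply/stable_classP; exact: stable_classK.
Qed.

Fact Sigma_map_id (X : E) :
  Sigma_map (stable_class (idm X)) = stable_class (idm (Sigma X)).
Proof. exact: Sigma_mapE (Sigma_rel1 X). Qed.

Fact Sigma_map_comp (X Y Z : E) (g : stable_hom Y Z) (f : stable_hom X Y) :
  Sigma_map (stable_comp g f) = stable_comp (Sigma_map g) (Sigma_map f).
Proof.
rewrite -(stable_classK g) -(stable_classK f) stable_classM.
have [sf rf] := Sigma_rel_exists (repr f).
have [sg rg] := Sigma_rel_exists (repr g).
by rewrite (Sigma_mapE rf) (Sigma_mapE rg) (Sigma_mapE (Sigma_relM rf rg)) stable_classM.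
Qed.

Fact Sigma_mapD (X Y : E) (f g : stable_hom X Y) :
  Sigma_map (f + g) = Sigma_map f + Sigma_map g.
Proof.
rewrite -(stable_classK g) -(stable_classK f) -stable_classD.
have [sf rf] := Sigma_rel_exists (repr f).
have [sg rg] := Sigma_rel_exists (repr g).
by rewrite (Sigma_mapE rf) (Sigma_mapE rg) (Sigma_mapE (Sigma_relD rf rg)) stable_classD.
Qed.

Definition stable_shift : additive_functor stable_preadditive stable_preadditive :=
  @AdditiveFunctor stable_preadditive stable_preadditive
    Sigma Sigma_map Sigma_map_id Sigma_map_comp Sigma_mapD.

(* The triangle of a conflation X -i-> Y -p-> Z: the third map is minus the
   class of the map b induced by an extension a of iota X along i.  The sign is
   the one for which X -> Y -> Z -> Sigma X is isomorphic to Happel's standard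
   triangle X -> Y -> C_i -> Sigma X, C_i being the pushout of i and iota X. *)
Definition standard_triangle (X Y Z : stable_preadditive) (u : hom X Y) (v : hom Y Z)
    (w : hom Z (stable_shift X)) : Prop :=
  exists (i : @hom E X Y) (p : @hom E Y Z) (a : @hom E Y (cosyzI X))
      (b : @hom E Z (Sigma X)),
    [/\ confl i p, a \oc i = iota X, b \oc p = piS X \oc a &
        [/\ u = stable_class i, v = stable_class p & w = - stable_class b]].

Definition stable_distinguished (X Y Z : stable_preadditive) (u : hom X Y)
    (v : hom Y Z) (w : hom Z (stable_shift X)) : Prop :=
  exists (X' Y' Z' : stable_preadditive) (u' : hom X' Y') (v' : hom Y' Z')
      (w' : hom Z' (stable_shift X')) (f : hom X X') (g : hom Y Y') (h : hom Z Z'),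
    [/\ standard_triangle u' v' w', is_iso f, is_iso g, is_iso h &
        [/\ u' \oc f = g \oc u, v' \oc g = h \oc v
          & w' \oc h = fmap stable_shift f \oc w]].

Definition stable : triangulation_data :=
  @TriangulationData stable_preadditive stable_shift stable_distinguished.

End Stable.

Section CommutativeAlgebra.
Variable S : comNzRingType.

(* [idealr S] is the library's type of proper ideals of S. *)
Definition maximal_ideal (I : idealr S) : Prop :=
  forall J : idealr S, {subset I <= J} -> {subset J <= I}.

Definition local_ring (n : idealr S) : Prop :=
  maximal_ideal n /\ forall m : idealr S, maximal_ideal m -> m =i n.

Definition noetherian : Prop :=
  forall I : {pred S}, 0 \in I -> {in I &, forall a b, a + b \in I} ->
    (forall c a, a \in I -> c * a \in I) ->
  exists (k : nat) (x : 'I_k -> S),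
    forall a, a \in I <-> exists c : 'I_k -> S, a = \sum_(i < k) c i * x i.

Definition non_zerodivisor (w : S) : Prop := forall a : S, w * a = 0 -> a = 0.

Implicit Types M N : lmodType S.

Section LinearMaps.
Variables M N : lmodType S.

Definition linear_pred : {pred M -> N} := fun f => `[< linear f >].

Lemma linear_pred_submod : submod_closed linear_pred.
Proof.
split; first by apply/asboolP => a x y /=; rewrite scaler0 addr0.
move=> a f g /asboolP lf /asboolP lg; apply/asboolP => b x y.
rewrite !fctE lf lg !scalerDr !scalerA (mulrC a b).
by rewrite -!addrA; congr (_ + _); rewrite addrCA.
Qed.

HB.instance Definition _ :=
  GRing.isSubmodClosed.Build S (M -> N) linear_pred linear_pred_submod.

Record lhom := Lhom { lhom_fun :> M -> N; lhomP : lhom_fun \in linear_pred }.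

HB.instance Definition _ := [isSub for lhom_fun].
HB.instance Definition _ := [Choice of lhom by <:].
HB.instance Definition _ := [SubChoice_isSubLmodule of lhom by <:].

Lemma lhom_linear (f : lhom) : linear f.
Proof. by case: f => f /= /asboolP. Qed.

HB.instance Definition _ (f : lhom) :=
  GRing.isLinear.Build S M N *:%R (lhom_fun f) (lhom_linear f).

Lemma lhom_ext (f g : lhom) : f =1 g -> f = g.
Proof. by move=> fg; apply: val_inj; apply/funext. Qed.

Definition mk_lhom (f : M -> N) (lf : linear f) : lhom := Lhom (introT (asboolP _) lf).

End LinearMaps.

Definition lhom_id M : lhom M M := @mk_lhom M M id (fun _ _ _ => erefl).

Fact lhom_comp_linear (M N L : lmodType S) (g : lhom N L) (f : lhom M N) :
  linear (g \o f).
Proof. by move=> a x y /=; rewrite !linearP. Qed.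

Definition lhom_comp (M N L : lmodType S) (g : lhom N L) (f : lhom M N) : lhom M L :=
  mk_lhom (lhom_comp_linear g f).

Definition dual M : lmodType S := lhom M S^o.

Fact eval_linear M (m : M) : linear (fun phi : dual M => phi m : S^o).
Proof. by []. Qed.

Definition biduality M (m : M) : dual (dual M) := mk_lhom (eval_linear m).

Definition fin_gen M : Prop :=
  exists (k : nat) (x : 'I_k -> M),
    forall m : M, exists c : 'I_k -> S, m = \sum_(i < k) c i *: x i.

Definition surj (A B : Type) (f : A -> B) : Prop := forall b, exists a, f a = b.

Definition exact_at (A B C : lmodType S) (f : lhom A B) (g : lhom B C) : Prop :=
  forall b : B, g b = 0 <-> exists a : A, f a = b.

Definition short_exact (A B C : lmodType S) (f : lhom A B) (g : lhom B C) : Prop :=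
  [/\ injective f, exact_at f g & surj g].

Definition projective_module M : Prop :=
  forall (A B : lmodType S) (p : lhom A B) (f : lhom M B),
    surj p -> exists g : lhom M A, forall m, p (g m) = f m.

(* ... -> P_2 -> P_1 -> P_0 -> M -> 0, with res_d i : P_i.+1 -> P_i. *)
Record projective_resolution M := ProjectiveResolution {
  res_mod : nat -> lmodType S;
  res_d : forall i, lhom (res_mod i.+1) (res_mod i);
  res_aug : lhom (res_mod 0%N) M;
  res_proj : forall i, projective_module (res_mod i);
  res_surj : surj res_aug;
  res_exact0 : exact_at (res_d 0%N) res_aug;
  res_exact : forall i, exact_at (res_d i.+1) (res_d i) }.

(* Ext^(i+1)(M, N) = 0: the cohomology of Hom(P, N) vanishes in degree i+1,
   P being any projective resolution of M. *)
Definition ExtS_vanishes (i : nat) M N : Prop :=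
  forall (P : projective_resolution M) (phi : lhom (res_mod P i.+1) N),
    (forall x, phi (res_d P i.+1 x) = 0) ->
    exists psi : lhom (res_mod P i) N, forall x, phi x = psi (res_d P i x).

Definition fg_projective M : Prop := fin_gen M /\ projective_module M.

Definition gorenstein_projective M : Prop :=
  [/\ fin_gen M,
      forall i, ExtS_vanishes i M S^o,
      forall i, ExtS_vanishes i (dual M) S^o
    & bijective (@biduality M)].

End CommutativeAlgebra.

Section MatrixFactorizations.
Variables (S : comNzRingType) (w : S) (X : lmodType S -> Prop).

Record mf := MatFact {
  mf1 : lmodType S;
  mf0 : lmodType S;
  mf_g1 : lhom mf1 mf0;
  mf_g0 : lhom mf0 mf1;
  mf1_in : X mf1;
  mf0_in : X mf0;
  mf_g1g0 : forall x : mf0, mf_g1 (mf_g0 x) = w *: x;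
  mf_g0g1 : forall x : mf1, mf_g0 (mf_g1 x) = w *: x }.

Section Morphisms.
Variables A B : mf.

Definition mf_commutes (phi : lhom (mf1 A) (mf1 B) * lhom (mf0 A) (mf0 B)) : Prop :=
  (forall x, mf_g1 B (phi.1 x) = phi.2 (mf_g1 A x)) /\
  (forall x, mf_g0 B (phi.2 x) = phi.1 (mf_g0 A x)).

Definition mf_pred : {pred lhom (mf1 A) (mf1 B) * lhom (mf0 A) (mf0 B)} :=
  fun phi => `[< mf_commutes phi >].

Lemma mf_zmod_closed : zmod_closed mf_pred.
Proof.
split; first by apply/asboolP; split=> x /=; rewrite linear0.
move=> f g /asboolP[f1 f0] /asboolP[g1 g0].
by apply/asboolP; split=> x /=; rewrite linearB /= ?f1 ?f0 ?g1 ?g0.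
Qed.

HB.instance Definition _ := GRing.isZmodClosed.Build _ mf_pred mf_zmod_closed.

Record mf_hom := MFHom {
  mf_pair : lhom (mf1 A) (mf1 B) * lhom (mf0 A) (mf0 B);
  mf_pairP : mf_pair \in mf_pred }.

HB.instance Definition _ := [isSub for mf_pair].
HB.instance Definition _ := [Choice of mf_hom by <:].
HB.instance Definition _ := [SubChoice_isSubZmodule of mf_hom by <:].

Definition phi1 (f : mf_hom) : lhom (mf1 A) (mf1 B) := (mf_pair f).1.
Definition phi0 (f : mf_hom) : lhom (mf0 A) (mf0 B) := (mf_pair f).2.

Lemma mf_homP (f : mf_hom) : mf_commutes (phi1 f, phi0 f).
Proof. by case: f => -[f1 f0] /= Pf; apply/asboolP. Qed.

Lemma mf_hom_ext (f g : mf_hom) : phi1 f =1 phi1 g -> phi0 f =1 phi0 g -> f = g.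
Proof.
case: f g => -[f1 f0] Pf [[g1 g0] Pg] /= e1 e0; apply: val_inj => /=.
by congr pair; exact: lhom_ext.
Qed.

Definition mk_mf_hom (f1 : lhom (mf1 A) (mf1 B)) (f0 : lhom (mf0 A) (mf0 B))
    (c : mf_commutes (f1, f0)) : mf_hom := MFHom (introT (asboolP _) c).

End Morphisms.

Fact mf_id_commutes (A : mf) : mf_commutes (A := A) (B := A) (lhom_id _, lhom_id _).
Proof. by []. Qed.

Definition mf_id (A : mf) : mf_hom A A := mk_mf_hom (mf_id_commutes A).

Fact mf_comp_commutes (A B C : mf) (g : mf_hom B C) (f : mf_hom A B) :
  mf_commutes (lhom_comp (phi1 g) (phi1 f), lhom_comp (phi0 g) (phi0 f)).
Proof.
have [g1 g0] := mf_homP g; have [f1 f0] := mf_homP f.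
by split=> x /=; [rewrite g1 f1 | rewrite g0 f0].
Qed.

Definition mf_comp (A B C : mf) (g : mf_hom B C) (f : mf_hom A B) : mf_hom A C :=
  mk_mf_hom (mf_comp_commutes g f).

Fact mf_compA (A B C D : mf) (h : mf_hom C D) (g : mf_hom B C) (f : mf_hom A B) :
  mf_comp h (mf_comp g f) = mf_comp (mf_comp h g) f.
Proof. exact: mf_hom_ext. Qed.

Fact mf_comp1m (A B : mf) (f : mf_hom A B) : mf_comp (mf_id B) f = f.
Proof. exact: mf_hom_ext. Qed.

Fact mf_compm1 (A B : mf) (f : mf_hom A B) : mf_comp f (mf_id A) = f.
Proof. exact: mf_hom_ext. Qed.

Fact mf_compDl (A B C : mf) (g h : mf_hom B C) (f : mf_hom A B) :
  mf_comp (g + h) f = mf_comp g f + mf_comp h f.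
Proof. exact: mf_hom_ext. Qed.

Fact mf_compDr (A B C : mf) (h : mf_hom B C) (f g : mf_hom A B) :
  mf_comp h (f + g) = mf_comp h f + mf_comp h g.
Proof. by apply: mf_hom_ext => x /=; rewrite linearD. Qed.

Definition mf_preadditive : preadditive :=
  @Preadditive mf mf_hom mf_id mf_comp
    mf_compA mf_comp1m mf_compm1 mf_compDl mf_compDr.

Definition mf_confl (A B C : mf_preadditive) (i : hom A B) (p : hom B C) : Prop :=
  short_exact (phi1 i) (phi1 p) /\ short_exact (phi0 i) (phi0 p).

Definition MF : exact_data := @ExactData mf_preadditive mf_confl.

End MatrixFactorizations.

Definition MF_G (S : comNzRingType) (w : S) : exact_data :=
  MF w (@gorenstein_projective S).

Definition in_MF_P (S : comNzRingType) (w : S) (A : MF_G w) : Prop :=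
  fg_projective (mf1 A) /\ fg_projective (mf0 A).

Definition MF_P (S : comNzRingType) (w : S) : exact_data :=
  full_subcategory (@in_MF_P S w).

(* Main.v *)
From HB Require Import structures.
From mathcomp Require Import all_boot all_algebra ring_quotient.
From mathcomp Require Import boolp.
Require Import Defs.

(* Gorenstein projectives and finitely generated projectives are both
   extension-closed classes of modules in which the finite free modules are
   enough projectives and enough injectives: every module of the class is a
   quotient of a free one with kernel in the class, and, dualizing a
   presentation of its dual, embeds in a free one with cokernel in the class.
   Componentwise exactness then makes factorizations with entries in such a
   class an exact category, and the contractible factorizations
   (F + F', 1 + w, w + 1) are both projective and injective in it.  Projectives
   and injectives are thus the retracts of these, a description which does not
   depend on the class; hence the two Frobenius structures have the same
   projectives, and a morphism of MF(w, P) factoring through a projective of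
   MF(w, G) does so in MF(w, P).
   Ext(-, S) is handled by dimension shifting: Ext^1(M, S) = 0 is phrased as
   extension of functionals along every short exact sequence ending in M, and
   Schanuel's lemma replaces the comparison of resolutions. *)

Set Implicit Arguments.
Unset Strict Implicit.
Unset Printing Implicit Defensive.

Import GRing.Theory.
Local Open Scope ring_scope.
Local Open Scope quotient_scope.

(** * Kernels, cokernels and finite generation *)

(** Both categories are treated at once as the factorizations of [MF w X] with entries in a class
    [Y] contained in [X]: [X] is the class of Gorenstein projectives throughout, while [Y] is either
    that class again or the finitely generated projectives. Keeping [X] fixed makes being a retract
    of a contractible factorization literally the same proposition in both cases. The stable
    categories raise another obstacle. Each shift rests on embeddings into injectives chosen
    separately in its own category, so the inclusion commutes with the shifts only up to an
    isomorphism. It is obtained by comparing the two chosen cosyzygies of an object; the comparison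
    can be reversed because injectives of the subcategory are projective there, hence projective and
    so injective in the larger category. *)

Section Modules.
Variable S : comNzRingType.
Implicit Types A B C D K L M N P Q T : lmodType S.

Lemma lhom_lin A B (f : lhom A B) r x y : f (r *: x + y) = r *: f x + f y.
Proof. exact: lhom_linear. Qed.

Lemma lhom0 A B (f : lhom A B) : f 0 = 0.
Proof. exact: linear0. Qed.

Lemma lhomD A B (f : lhom A B) x y : f (x + y) = f x + f y.
Proof. exact: linearD. Qed.

Lemma lhomB A B (f : lhom A B) x y : f (x - y) = f x - f y.
Proof. exact: linearB. Qed.

Lemma lhomN A B (f : lhom A B) x : f (- x) = - f x.
Proof. exact: linearN. Qed.

Lemma lhomZ A B (f : lhom A B) r x : f (r *: x) = r *: f x.
Proof. exact: linearZ. Qed.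

Lemma lhom_sum A B (f : lhom A B) k (x : 'I_k -> A) :
  f (\sum_i x i) = \sum_i f (x i).
Proof. exact: linear_sum. Qed.

Lemma lhom_addE A B (f g : lhom A B) x : (f + g) x = f x + g x.
Proof. by []. Qed.

Lemma lhom_oppE A B (f : lhom A B) x : (- f) x = - f x.
Proof. by []. Qed.

Lemma lhom_compE A B C (g : lhom B C) (f : lhom A B) x : lhom_comp g f x = g (f x).
Proof. by []. Qed.

Lemma lhom_idE A x : lhom_id A x = x.
Proof. by []. Qed.

Lemma lhom_zeroE A B x : (0 : lhom A B) x = 0.
Proof. by []. Qed.

Definition lhomE := (lhom_addE, lhom_oppE, lhom_compE, lhom_idE, lhom_zeroE).

Section Kernel.
Variables (A B : lmodType S) (f : lhom A B).

Definition ker_pred : {pred A} := fun a => f a == 0.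

Fact ker_pred_submod : submod_closed ker_pred.
Proof.
split=> [|a x y /eqP fx /eqP fy]; apply/eqP; first by rewrite lhom0.
by rewrite lhom_lin fx fy scaler0 addr0.
Qed.

HB.instance Definition _ := GRing.isSubmodClosed.Build S A ker_pred ker_pred_submod.

Record ker_mod := KerMod { ker_val :> A; ker_valP : ker_val \in ker_pred }.

HB.instance Definition _ := [isSub for ker_val].
HB.instance Definition _ := [Choice of ker_mod by <:].
HB.instance Definition _ := [SubChoice_isSubLmodule of ker_mod by <:].

Lemma kernel_exists :
  exists (K : lmodType S) (i : lhom K A), injective i /\ exact_at i f.
Proof.
have li : linear ker_val by [].
exists ker_mod, (mk_lhom li); split; first exact: val_inj.
move=> a; split=> [fa|[k <-]]; last exact/eqP/ker_valP.
have ka : a \in ker_pred by apply/eqP.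
by exists (KerMod ka).
Qed.

End Kernel.

Section Cokernel.
Variables (A B : lmodType S) (f : lhom A B).

Definition im_pred : {pred B} := fun b => `[< exists a, f a = b >].

Fact im_pred_zmod : zmod_closed im_pred.
Proof.
split=> [|x y /asboolP[a <-] /asboolP[b <-]]; apply/asboolP.
  by exists 0; rewrite lhom0.
by exists (a - b); rewrite lhomB.
Qed.

HB.instance Definition _ := GRing.isZmodClosed.Build B im_pred im_pred_zmod.

Definition coker_mod := Quotient.quot im_pred.

HB.instance Definition _ := GRing.Zmodule.on coker_mod.

Definition coker_pi (b : B) : coker_mod := \pi b.

Lemma coker_piP (b c : B) : coker_pi b = coker_pi c <-> exists a, f a = b - c.
Proof.
rewrite /coker_pi; split=> [/eqP|[a e]].
  by rewrite -Quotient.idealrBE => /asboolP.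
by apply/eqP; rewrite -Quotient.idealrBE; apply/asboolP; exists a.
Qed.

Lemma coker_piK (x : coker_mod) : coker_pi (repr x) = x.
Proof. exact: reprK. Qed.

Lemma coker_piD b c : coker_pi (b + c) = coker_pi b + coker_pi c.
Proof. exact: raddfD. Qed.

(** [Quotient.quot] is used as a quotient of additive groups; scalars act through representatives,
    which is well defined because the image of [f] is stable under scaling. *)
Definition coker_scale (r : S) (x : coker_mod) : coker_mod := coker_pi (r *: repr x).

Lemma coker_scaleE r b : coker_scale r (coker_pi b) = coker_pi (r *: b).
Proof.
apply/coker_piP; have /coker_piP[a e] := coker_piK (coker_pi b).
by exists (r *: a); rewrite lhomZ e scalerBr.
Qed.

Fact coker_scaleA r s x : coker_scale r (coker_scale s x) = coker_scale (r * s) x.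
Proof. by rewrite -(coker_piK x) !coker_scaleE scalerA. Qed.

Fact coker_scale1 : left_id 1 coker_scale.
Proof. by move=> x; rewrite -(coker_piK x) coker_scaleE scale1r. Qed.

Fact coker_scaleDr : right_distributive coker_scale +%R.
Proof.
move=> r x y; rewrite -(coker_piK x) -(coker_piK y) -coker_piD.
by rewrite !coker_scaleE scalerDr coker_piD.
Qed.

Fact coker_scaleDl x : {morph coker_scale^~ x : r s / r + s}.
Proof. by move=> r s; rewrite -(coker_piK x) !coker_scaleE scalerDl coker_piD. Qed.

HB.instance Definition _ := GRing.Zmodule_isLmodule.Build S coker_mod
  coker_scaleA coker_scale1 coker_scaleDr coker_scaleDl.

Lemma cokernel_exists :
  exists (C : lmodType S) (q : lhom B C), surj q /\ exact_at f q.
Proof.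
have lq : linear coker_pi.
  by move=> r x y; rewrite coker_piD -coker_scaleE.
have pi0 : coker_pi 0 = 0 by exact: raddf0.
exists coker_mod, (mk_lhom lq); split.
  by move=> x; exists (repr x); exact: coker_piK.
move=> b; split=> [/=|[a fa]].
  by rewrite -pi0 => /coker_piP[a e]; exists a; rewrite e subr0.
by rewrite /= -pi0; apply/coker_piP; exists a; rewrite subr0.
Qed.

End Cokernel.

(** Preimages are chosen pointwise; injectivity of [i] makes them unique, and uniqueness makes the
    choice linear. *)
Lemma lhom_lift_inj A B T (i : lhom A B) (f : lhom T B) :
  injective i -> (forall t, exists a, i a = f t) ->
  exists g : lhom T A, forall t, i (g t) = f t.
Proof.
move=> ii ex; pose g t := sval (cid (ex t)).
have gE t : i (g t) = f t by exact: svalP (cid (ex t)).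
have lg : linear g by move=> r x y; apply: ii; rewrite lhom_lin !gE lhom_lin.
by exists (mk_lhom lg).
Qed.

(** Two preimages of a point differ by an element killed by [p], hence by [f]; the chosen preimage
    is therefore immaterial and linearity can be checked on images of [p]. *)
Lemma lhom_factor_surj B C T (p : lhom B C) (f : lhom B T) :
  surj p -> (forall b, p b = 0 -> f b = 0) ->
  exists g : lhom C T, forall b, g (p b) = f b.
Proof.
move=> sp pf; pose g c := f (sval (cid (sp c))).
have gE b : g (p b) = f b.
  rewrite /g; case: cid => b' /= e; apply/eqP; rewrite -subr_eq0 -lhomB.
  by apply/eqP/pf; rewrite lhomB e subrr.
have lg : linear g.
  move=> r x y; have [b <-] := sp x; have [c <-] := sp y.
  by rewrite -lhom_lin !gE lhom_lin.
by exists (mk_lhom lg).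
Qed.

Lemma short_exact0 A B C (i : lhom A B) (p : lhom B C) :
  short_exact i p -> forall a, p (i a) = 0.
Proof. by move=> [_ e _] a; apply/e; exists a. Qed.

Lemma lhom_injP A B (f : lhom A B) : (forall a, f a = 0 -> a = 0) -> injective f.
Proof.
move=> f0 a b e; apply/eqP; rewrite -subr_eq0; apply/eqP/f0.
by rewrite lhomB e subrr.
Qed.

Lemma lhom_inj0 A B (f : lhom A B) : injective f -> forall a, f a = 0 -> a = 0.
Proof. by move=> fi a fa; apply: fi; rewrite fa lhom0. Qed.

End Modules.

Section FinitelyGenerated.
Variable S : comNzRingType.
Implicit Types A B C D K L M N P Q T : lmodType S.

Lemma comb_linear M k (x : 'I_k -> M) :
  linear (fun v : 'rV[S]_k => \sum_i v 0 i *: x i).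
Proof.
move=> r u v; rewrite scaler_sumr -big_split; apply: eq_bigr => i _ /=.
by rewrite !mxE scalerDl scalerA.
Qed.

Definition comb M k (x : 'I_k -> M) : lhom 'rV[S]_k M := mk_lhom (comb_linear x).

Lemma combE M k (x : 'I_k -> M) v : comb x v = \sum_i v 0 i *: x i.
Proof. by []. Qed.

Lemma coords_linear M k (s : 'I_k -> dual M) :
  linear (fun m => \row_i s i m : 'rV[S]_k).
Proof. by move=> r u v; apply/rowP => i; rewrite !mxE lhom_lin. Qed.

Definition coords M k (s : 'I_k -> dual M) : lhom M 'rV[S]_k := mk_lhom (coords_linear s).

Lemma coordsE M k (s : 'I_k -> dual M) m i : coords s m 0 i = s i m.
Proof. by rewrite mxE. Qed.

Lemma lhom_row k M (f : lhom 'rV[S]_k M) v : f v = comb (fun i => f (delta_mx 0 i)) v.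
Proof.
rewrite {1}(row_sum_delta v) lhom_sum; apply: eq_bigr => i _; exact: lhomZ.
Qed.

Lemma fin_genP M : fin_gen M <-> exists (k : nat) (p : lhom 'rV[S]_k M), surj p.
Proof.
split=> [[k [x gx]]|[k [p sp]]].
  exists k, (comb x) => m; have [c ->] := gx m; exists (\row_i c i).
  by rewrite combE; apply: eq_bigr => i _; rewrite mxE.
exists k, (fun i => p (delta_mx 0 i)) => m; have [v <-] := sp m.
by exists (fun i => v 0 i); exact: lhom_row.
Qed.

Lemma fin_gen_surj A B (p : lhom A B) : surj p -> fin_gen A -> fin_gen B.
Proof.
move=> sp /fin_genP[k [q sq]]; apply/fin_genP; exists k, (lhom_comp p q) => b.
by have [a <-] := sp b; have [v <-] := sq a; exists v.
Qed.

Lemma fin_gen_row k : fin_gen ('rV[S]_k : lmodType S).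
Proof. by apply/fin_genP; exists k, (lhom_id _) => v; exists v. Qed.

Lemma fin_gen_ext A B C (i : lhom A B) (p : lhom B C) :
  short_exact i p -> fin_gen A -> fin_gen C -> fin_gen B.
Proof.
move=> [ii e sp] [k [x gx]] [l [y gy]].
have [z zy] := choice (fun j => sp (y j)).
pose g (t : 'I_(k + l)) := match split t with inl j => i (x j) | inr j => z j end.
exists (k + l)%N, g => b; have [c cE] := gy (p b).
have [|a ia] := (e (b - \sum_j c j *: z j)).1.
  rewrite lhomB lhom_sum cE; apply/eqP; rewrite subr_eq0; apply/eqP.
  by apply: eq_bigr => j _; rewrite lhomZ zy.
have [d dE] := gx a.
exists (fun t => match split t with inl j => d j | inr j => c j end).
rewrite big_split_ord /= -[LHS](subrK (\sum_j c j *: z j)) -ia dE lhom_sum.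
congr (_ + _); apply: eq_bigr => j _; rewrite /g.
  by rewrite -[lshift _ _]/(unsplit (inl j)) unsplitK lhomZ.
by rewrite -[rshift _ _]/(unsplit (inr j)) unsplitK.
Qed.

(** Induction on the rank. The first coordinate maps A onto an ideal, which is finitely generated,
    and the kernel of that map embeds in the remaining k coordinates. Lifts of generators of the
    ideal together with generators of the kernel generate A. *)
Lemma fin_gen_inj_row k A (i : lhom A 'rV[S]_k) :
  noetherian S -> injective i -> fin_gen A.
Proof.
move=> noeth; elim: k A i => [|k IH] A i ii.
  exists 0%N, (fun=> 0) => a; exists (fun=> 0); rewrite big_ord0; apply: ii.
  by apply/rowP => -[].
pose c (v : 'rV[S]_(1 + k)) : S^o := v 0 0.
have lc : linear c by move=> r u v; rewrite /c !mxE.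
pose h : lhom A S^o := lhom_comp (mk_lhom lc) i.
have [K [j [ij jh]]] := kernel_exists h.
have lr : linear (@rsubmx S 1 1 k) by move=> r u v; rewrite linearP.
have Kfg : fin_gen K.
  apply: (IH K (lhom_comp (mk_lhom lr) (lhom_comp i j))).
  apply: lhom_injP => x /= rx; apply: (lhom_inj0 ij); apply: (lhom_inj0 ii).
  have hx : h (j x) = 0 by apply/jh; exists x.
  pose v : 'rV[S]_(1 + k) := i (j x); change (v = 0).
  rewrite -[v]hsubmxK [rsubmx v]rx -[RHS](@row_mx0 _ 1 1 k); congr row_mx.
  apply/matrixP => s t; rewrite !ord1 mxE [RHS]mxE -[RHS]hx.
  by congr (v _ _); apply: val_inj.
pose I : {pred S} := fun r => `[< exists a, h a = r >].
have [||r a|l [x gx]] := noeth I.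
- by apply/asboolP; exists 0; rewrite lhom0.
- by move=> a b /asboolP[u <-] /asboolP[v <-]; apply/asboolP; exists (u + v); rewrite lhomD.
- by move=> /asboolP[u <-]; apply/asboolP; exists (r *: u); rewrite lhomZ.
have Ix t : exists a, h a = x t.
  apply/asboolP; apply/gx; exists (fun s => (s == t)%:R).
  rewrite (bigD1 t) //= eqxx mul1r big1 ?addr0 // => s /negPf ->.
  by rewrite mul0r.
have [y hy] := choice Ix.
have [k' [z gz]] := Kfg.
pose g (t : 'I_(k' + l)) := match split t with inl s => j (z s) | inr s => y s end.
exists (k' + l)%N, g => a.
have /gx[d dE] : h a \in I by apply/asboolP; exists a.
have [|u ju] := (jh (a - \sum_s d s *: y s)).1.
  rewrite lhomB lhom_sum dE; apply/eqP; rewrite subr_eq0; apply/eqP.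
  by apply: eq_bigr => s _; rewrite lhomZ hy.
have [e eE] := gz u.
exists (fun t => match split t with inl s => e s | inr s => d s end).
rewrite big_split_ord /= -[LHS](subrK (\sum_s d s *: y s)) -ju eE lhom_sum.
congr (_ + _); apply: eq_bigr => s _; rewrite /g.
  by rewrite -[lshift _ _]/(unsplit (inl s)) unsplitK lhomZ.
by rewrite -[rshift _ _]/(unsplit (inr s)) unsplitK.
Qed.

(** * Products and pullbacks of modules *)

Lemma pair_linear A B C (f : lhom C A) (g : lhom C B) :
  linear (fun c => (f c, g c) : A * B).
Proof. by move=> r x y; rewrite !lhom_lin. Qed.

Definition lhom_pair A B C (f : lhom C A) (g : lhom C B) :
  lhom C (A * B)%type := mk_lhom (pair_linear f g).

Lemma copair_linear A B C (f : lhom A C) (g : lhom B C) :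
  linear (fun x : A * B => f x.1 + g x.2).
Proof.
move=> r x y /=; rewrite !lhom_lin scalerDr -!addrA; congr (_ + _).
by rewrite addrCA.
Qed.

Definition lhom_copair A B C (f : lhom A C) (g : lhom B C) :
  lhom (A * B)%type C := mk_lhom (copair_linear f g).

(** Built from [lhom_copair], so linearity comes for free; the values compute to [x.1 + 0] and
    [0 + x.2], which [lhom_fstE] and [lhom_sndE] tidy up. *)
Definition lhom_fst A B : lhom (A * B)%type A := lhom_copair (lhom_id A) 0.
Definition lhom_snd A B : lhom (A * B)%type B := lhom_copair 0 (lhom_id B).
Definition lhom_inl A B : lhom A (A * B)%type := lhom_pair (lhom_id A) 0.
Definition lhom_inr A B : lhom B (A * B)%type := lhom_pair 0 (lhom_id B).

Lemma lhom_fstE A B x : lhom_fst A B x = x.1.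
Proof. exact: addr0. Qed.

Lemma lhom_sndE A B x : lhom_snd A B x = x.2.
Proof. exact: add0r. Qed.

Lemma short_exact_prod A B : short_exact (lhom_inl A B) (lhom_snd A B).
Proof.
split=> [x y [] //|[a b]|b]; last by exists (0, b); rewrite lhom_sndE.
rewrite lhom_sndE /=; split=> [->|[x [_ <-]] //].
by exists a.
Qed.

(** The kernel of (f, -g) on the product. In place of the universal property it is described by
    elements: joint injectivity of the projections, and a point over each compatible pair. *)
Lemma pullback_exists A B C (f : lhom A C) (g : lhom B C) :
  exists (W : lmodType S) (p : lhom W A) (q : lhom W B),
    [/\ forall x, f (p x) = g (q x),
        forall x, p x = 0 -> q x = 0 -> x = 0
      & forall a b, f a = g b -> exists x, p x = a /\ q x = b].
Proof.
have [W [i [ii e]]] := kernel_exists (lhom_copair f (- g)).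
exists W, (lhom_comp (lhom_fst A B) i), (lhom_comp (lhom_snd A B) i).
split=> [x|x|a b ab].
- have /eqP := (e (i x)).2 (ex_intro _ x erefl).
  by rewrite /= addr0 add0r subr_eq0 => /eqP.
- rewrite -![lhom_comp _ _ _]/(_ (i x)) lhom_fstE lhom_sndE => x1 x2.
  by apply: (lhom_inj0 ii); case: (i x) x1 x2 => /= ? ? -> ->.
have [|x ix] := (e (a, b)).1; first by rewrite /= ab subrr.
exists x; rewrite -![lhom_comp _ _ _]/(_ (i x)) lhom_fstE lhom_sndE ix.
by [].
Qed.

(** Pulling a free cover of B back along [i] gives a submodule of a free module that maps onto A. *)
Lemma fin_gen_inj A B (i : lhom A B) :
  noetherian S -> injective i -> fin_gen B -> fin_gen A.
Proof.
move=> noeth ii /fin_genP[k [p sp]].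
have [W [f [g [fg f0 ex]]]] := pullback_exists i p.
apply: (@fin_gen_surj W _ f).
  by move=> a; have [v pv] := sp (i a); have [|x [<- _]] := ex a v => //; exists x.
apply: (@fin_gen_inj_row _ _ g noeth); apply: lhom_injP => x gx.
by apply: f0 => //; apply: (lhom_inj0 ii); rewrite fg gx lhom0.
Qed.

(** * Projective modules and dual bases *)

Lemma projective_row k : projective_module ('rV[S]_k : lmodType S).
Proof.
move=> A B p f sp; have [x px] := choice (fun i : 'I_k => sp (f (delta_mx 0 i))).
exists (comb x) => v; rewrite [RHS]lhom_row /= lhom_sum; apply: eq_bigr => i _.
by rewrite lhomZ px.
Qed.

Lemma projective_section A P (p : lhom A P) :
  projective_module P -> surj p -> exists s : lhom P A, forall x, p (s x) = x.
Proof. by move=> PP sp; exact: (PP _ _ p (lhom_id P) sp). Qed.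

Lemma projective_retract P M (s : lhom M P) (r : lhom P M) :
  (forall x, r (s x) = x) -> projective_module P -> projective_module M.
Proof.
move=> rs PP A B p f sp; have [g gE] := PP _ _ p (lhom_comp f r) sp.
by exists (lhom_comp g s) => m; rewrite /= gE /= rs.
Qed.

Lemma short_exact_split A B C (i : lhom A B) (p : lhom B C) (s : lhom C B) :
  short_exact i p -> (forall c, p (s c) = c) ->
  exists r : lhom B A, (forall a, r (i a) = a) /\
                       (forall b, i (r b) + s (p b) = b).
Proof.
move=> ip ps; have [ii e _] := ip.
have [|r rE] := lhom_lift_inj (f := lhom_id B - lhom_comp s p) ii.
  by move=> b; apply/e; rewrite /= lhomB ps subrr.
exists r; split=> [a|b]; last by rewrite rE /= subrK.
by apply: ii; rewrite rE !lhomE (short_exact0 ip) lhom0 subr0.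
Qed.

Lemma projective_ker A B C (i : lhom A B) (p : lhom B C) :
  short_exact i p -> projective_module B -> projective_module C ->
  projective_module A.
Proof.
move=> ip PB PC; have [_ _ sp] := ip; have [s ps] := projective_section PC sp.
by have [r [ri _]] := short_exact_split ip ps; exact: projective_retract ri PB.
Qed.

Lemma projective_ext A B C (i : lhom A B) (p : lhom B C) :
  short_exact i p -> projective_module A -> projective_module C ->
  projective_module B.
Proof.
move=> ip PA PC U V q f sq; have [_ _ sp] := ip.
have [s ps] := projective_section PC sp.
have [r [ri rs]] := short_exact_split ip ps.
have [g gE] := PA _ _ q (lhom_comp f i) sq.
have [h hE] := PC _ _ q (lhom_comp f s) sq.
exists (lhom_comp g r + lhom_comp h p) => b.
by rewrite /= lhomD gE hE /= -lhomD rs.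
Qed.

Lemma fin_gen_projective_ker A B C (i : lhom A B) (p : lhom B C) :
  short_exact i p -> fin_gen B -> projective_module C -> fin_gen A.
Proof.
move=> ip fB PC; have [_ _ sp] := ip; have [s ps] := projective_section PC sp.
have [r [ri _]] := short_exact_split ip ps.
by apply: (fin_gen_surj _ fB) => a; exists (i a).
Qed.

(** The dual basis lemma. The functionals are the coordinates of a section of a free cover;
    conversely they exhibit M as a retract of a free module. It turns statements about duals of
    projectives into explicit formulas. *)
Lemma dual_basisP M : fg_projective M <->
  exists (k : nat) (x : 'I_k -> M) (s : 'I_k -> dual M),
    forall m, m = \sum_i (s i m : S) *: x i.
Proof.
split=> [[/fin_genP[k [p sp]] PM]|[k [x [s e]]]].
  have [t pt] := projective_section PM sp.
  have lc i : linear (fun m => t m 0 i : S^o) by move=> r u v; rewrite lhom_lin !mxE.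
  exists k, (fun i => p (delta_mx 0 i)), (fun i => mk_lhom (lc i)) => m.
  by rewrite -[LHS]pt lhom_row.
have xs m : comb x (coords s m) = m.
  by rewrite [RHS]e; apply: eq_bigr => i _; rewrite coordsE.
split; first by apply/fin_genP; exists k, (comb x) => m; exists (coords s m).
exact: projective_retract xs (@projective_row k).
Qed.

Lemma dual_sum M k (c : 'I_k -> S) (s : 'I_k -> dual M) m :
  (\sum_i c i *: s i) m = \sum_i c i * s i m.
Proof. exact: (lhom_sum (biduality m)). Qed.

(** A dual basis of M read with its two halves exchanged, the elements of M acting on functionals by
    evaluation. *)
Lemma fg_projective_dual M : fg_projective M -> fg_projective (dual M).
Proof.
move=> /dual_basisP[k [x [s e]]]; apply/dual_basisP.
exists k, s, (fun i => biduality (x i)) => f; apply: lhom_ext => m.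
rewrite dual_sum [in LHS](e m) lhom_sum; apply: eq_bigr => i _.
by rewrite lhomZ; exact: mulrC.
Qed.

Lemma fg_projective_biduality M : fg_projective M -> bijective (@biduality S M).
Proof.
move=> /dual_basisP[k [x [s e]]].
exists (fun xi : dual (dual M) => \sum_i (xi (s i) : S) *: x i) => [m|xi].
  by rewrite [RHS]e.
apply: lhom_ext => f; rewrite /= lhom_sum.
have {2}-> : f = \sum_i (f (x i) : S) *: s i.
  apply: lhom_ext => m; rewrite dual_sum [in LHS](e m) lhom_sum.
  by apply: eq_bigr => i _; rewrite lhomZ; exact: mulrC.
by rewrite lhom_sum; apply: eq_bigr => i _; rewrite !lhomZ; exact: mulrC.
Qed.

(** A functional is determined by its values on generators, so the dual embeds in a free module of
    finite rank. *)
Lemma fin_gen_dual M : noetherian S -> fin_gen M -> fin_gen (dual M).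
Proof.
move=> noeth [k [x gx]].
apply: (@fin_gen_inj_row _ _ (coords (fun i => biduality (x i))) noeth).
apply: lhom_injP => f /rowP f0; apply: lhom_ext => m; have [c ->] := gx m.
rewrite lhom_sum big1 // => i _; have := f0 i; rewrite coordsE mxE /= => f0i.
by rewrite lhomZ f0i scaler0.
Qed.

End FinitelyGenerated.

(** * Vanishing of Ext(-, S) *)

Section Perpendicular.
Variable S : comNzRingType.
Implicit Types A B C D K L M N P Q T : lmodType S.

Definition dual_surj A B (i : lhom A B) : Prop :=
  forall f : dual A, exists g : dual B, forall a, g (i a) = f a.

Definition ext1_vanishes M : Prop :=
  forall A B (i : lhom A B) (p : lhom B M), short_exact i p -> dual_surj i.

Lemma split_dual_surj A B (i : lhom A B) (r : lhom B A) :
  (forall a, r (i a) = a) -> dual_surj i.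
Proof. by move=> ri f; exists (lhom_comp f r) => a; rewrite lhomE ri. Qed.

Lemma ext1_projective P : projective_module P -> ext1_vanishes P.
Proof.
move=> PP A B i p ip; have [_ _ sp] := ip; have [s ps] := projective_section PP sp.
by have [r [ri _]] := short_exact_split ip ps; exact: split_dual_surj ri.
Qed.

(** An extension of A is pulled back along [r] to an extension of B. There the functional extends,
    and the section [s] brings the extension back. *)
Lemma ext1_retract A B (s : lhom A B) (r : lhom B A) :
  (forall a, r (s a) = a) -> ext1_vanishes B -> ext1_vanishes A.
Proof.
move=> rs EB U V i p ip f; have [ii e sp] := ip.
have [W [a [b [ab ab0 ex]]]] := pullback_exists p r.
have [j [ja jb]] : exists j : lhom U W, (forall u, a (j u) = i u) /\ forall u, b (j u) = 0.
  have [||j jE] := @lhom_lift_inj _ _ _ _ (lhom_pair a b) (lhom_pair i 0).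
  - by apply: lhom_injP => w [/ab0 w0 /w0].
  - move=> u; have [|w [aw bw]] := ex (i u) 0; first by rewrite lhom0 (short_exact0 ip).
    by exists w; congr pair.
  by exists j; split=> u; have [] := jE u.
have jb_ex : short_exact j b.
  split=> [x y jxy|w|c].
  - by apply: ii; rewrite -!ja jxy.
  - split=> [bw|[u <-] //].
    have [|u iu] := (e (a w)).1; first by rewrite ab bw lhom0.
    exists u; apply/eqP; rewrite -subr_eq0; apply/eqP; apply: ab0.
      by rewrite lhomB ja iu subrr.
    by rewrite lhomB jb bw subrr.
  - have [v pv] := sp (r c); have [|w [_ bw]] := ex v c; first by [].
    by exists w.
have [g gE] := EB _ _ _ _ jb_ex f.
(* Since r s = id, the pair (v, s (p v)) lies in the pullback; this maps V into W compatibly with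
   the two copies of U. *)
have [||k kE] := @lhom_lift_inj _ _ _ _ (lhom_pair a b)
    (lhom_pair (lhom_id V) (lhom_comp s p)).
- by apply: lhom_injP => w [/ab0 w0 /w0].
- move=> v; have [|w [aw bw]] := ex v (s (p v)); first by rewrite rs.
  by exists w; congr pair.
exists (lhom_comp g k) => u; rewrite lhomE -gE; congr (g _).
have [ak bk] := kE (i u); apply/eqP; rewrite -subr_eq0; apply/eqP; apply: ab0.
  by rewrite lhomB ja ak subrr.
by rewrite lhomB jb bk /= (short_exact0 ip) lhom0 subrr.
Qed.

(** In an extension V of B by U, let W be the preimage of A. Then W is an extension of A by U, and V
    is an extension of C by W, so a functional extends from U to W and from W to V. *)
Lemma ext1_ext A B C (i : lhom A B) (p : lhom B C) :
  short_exact i p -> ext1_vanishes A -> ext1_vanishes C -> ext1_vanishes B.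
Proof.
move=> [ii e sp] EA EC U V j q [ij f sq] h.
have [W [c [d [cd cd0 ex]]]] := pullback_exists q i.
have ic : injective c.
  apply: lhom_injP => w cw; apply: cd0 => //; apply: (lhom_inj0 ii).
  by rewrite -cd cw lhom0.
have qj u : q (j u) = 0 by apply/f; exists u.
have [|k kE] := lhom_lift_inj (f := j) ic.
  by move=> u; have [|w [cw _]] := ex (j u) 0; [rewrite qj lhom0|exists w].
have dk u : d (k u) = 0 by apply: (lhom_inj0 ii); rewrite -cd kE qj.
have kd : short_exact k d.
  split=> [x y kxy|w|a].
  - by apply: ij; rewrite -!kE kxy.
  - split=> [dw|[u <-] //].
    have [|u ju] := (f (c w)).1; first by rewrite cd dw lhom0.
    by exists u; apply: ic; rewrite kE.
  - by have [v qv] := sq (i a); have [|w [_ dw]] := ex v a; [|exists w].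
have [g gE] := EA _ _ _ _ kd h.
have cpq : short_exact c (lhom_comp p q).
  split=> // [v|x].
    rewrite lhomE; split=> [/e[a ia]|[w <-]]; last by rewrite cd; apply/e; exists (d w).
    by have [|w [cw _]] := ex v a; [|exists w].
  by have [b pb] := sp x; have [v qv] := sq b; exists v; rewrite lhomE qv.
have [g' g'E] := EC _ _ _ _ cpq g.
by exists g' => u; rewrite -kE g'E gE.
Qed.

(** The piece Hom(L, S) -> Hom(K, S) -> Ext^1(A, S) -> Ext^1(L, S) of the long exact sequence,
    chased by hand: an extension V of A by U is pulled back along [q] to W, which contains both U
    and K. *)
Lemma ext1_quot A K L (j : lhom K L) (q : lhom L A) :
  short_exact j q -> ext1_vanishes L -> dual_surj j -> ext1_vanishes A.
Proof.
move=> [ij e sq] EL dj U V i p [ii f sp] h.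
have [W [a [b [ab ab0 ex]]]] := pullback_exists p q.
have pi u : p (i u) = 0 by apply/f; exists u.
have qj x : q (j x) = 0 by apply/e; exists x.
have iab : injective (lhom_pair a b) by apply: lhom_injP => w [/ab0 w0 /w0].
have [|k kE] := lhom_lift_inj (f := lhom_pair i 0) iab.
  move=> u; have [|w [aw bw]] := ex (i u) 0; first by rewrite lhom0 pi.
  by exists w; congr pair.
have [|l lE] := lhom_lift_inj (f := lhom_pair 0 j) iab.
  move=> x; have [|w [aw bw]] := ex 0 (j x); first by rewrite lhom0 qj.
  by exists w; congr pair.
have ak u : a (k u) = i u by have [] := kE u.
have bk u : b (k u) = 0 by have [] := kE u.
have al x : a (l x) = 0 by have [] := lE x.
have bl x : b (l x) = j x by have [] := lE x.
have kb : short_exact k b.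
  split=> [x y kxy|w|y].
  - by apply: ii; rewrite -!ak kxy.
  - split=> [bw|[u <-] //].
    have [|u iu] := (f (a w)).1; first by rewrite ab bw lhom0.
    by exists u; apply: iab; congr pair; rewrite ?ak ?bk.
  - by have [v pv] := sp (q y); have [|w [_ bw]] := ex v y; [|exists w].
have [g gE] := EL _ _ _ _ kb h.
have [g' g'E] := dj (lhom_comp g l).
(* Subtracting g' b makes the extended functional vanish on the copy of K, which is the kernel of W
   -> V, and leaves it unchanged on U, where [b] is zero. *)
have [||t tE] := @lhom_factor_surj _ _ _ _ a (g - lhom_comp g' b).
- by move=> v; have [y qy] := sq (p v); have [|w [aw _]] := ex v y; [|exists w].
- move=> w aw; have [|x jx] := (e (b w)).1; first by rewrite -ab aw lhom0.
  have -> : w = l x by apply: iab; congr pair; rewrite ?al ?bl.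
  by rewrite !lhomE bl g'E lhomE subrr.
by exists t => u; rewrite -ak tE !lhomE bk lhom0 subr0 gE.
Qed.

(* Ext^i(M, S) = 0 for 1 <= i <= n + 1, by dimension shifting along all
   projective presentations at once. *)
Fixpoint perp (n : nat) M : Prop :=
  ext1_vanishes M /\
  if n is m.+1 then
    forall K P (i : lhom K P) (p : lhom P M),
      projective_module P -> short_exact i p -> perp m K
  else True.

Lemma perp_ext1 n M : perp n M -> ext1_vanishes M.
Proof. by case: n => [|n] []. Qed.

Lemma perpS n K P M (i : lhom K P) (p : lhom P M) :
  perp n.+1 M -> projective_module P -> short_exact i p -> perp n K.
Proof. by move=> [_ H]; exact: H. Qed.

(** B is A plus the summand P, and P can be moved in or out of the middle term of a presentation
    without changing the kernel. Presentations of A and B thus have the same kernels to test, and no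
    induction on n is required. *)
Lemma perp_add_projective n A B P (i : lhom A B) (p : lhom B P) :
  short_exact i p -> projective_module P -> perp n A <-> perp n B.
Proof.
move=> ip PP; have [ii e sp] := ip; have [s ps] := projective_section PP sp.
have [r [ri rs]] := short_exact_split ip ps.
have extAB : ext1_vanishes A <-> ext1_vanishes B.
  by split=> [EA|]; [apply: ext1_ext ip EA (ext1_projective PP)|exact: ext1_retract].
case: n => [|n]; first by rewrite /perp; tauto.
split=> -[/extAB E1 H]; split=> //.
(* L is the preimage of A in Q: projective as the kernel of a surjection between projectives, and a
   cover of A with the same kernel K. *)
- move=> K Q j q PQ [ij f sq]; have [L [l [il el]]] := kernel_exists (lhom_comp p q).
  have pq : short_exact l (lhom_comp p q).
    split=> // x; have [b pb] := sp x; have [y qy] := sq b.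
    by exists y; rewrite lhomE qy.
  have PL := projective_ker pq PQ PP.
  have lq x : p (q (l x)) = 0 by exact: short_exact0 pq x.
  have [|j' j'E] := lhom_lift_inj (f := j) il.
    move=> k; apply/el; rewrite lhomE; have -> : q (j k) = 0 by apply/f; exists k.
    by rewrite lhom0.
  have [|q' q'E] := lhom_lift_inj (f := lhom_comp q l) ii.
    by move=> x; apply/e; rewrite lhomE.
  apply: (H K L j' q' PL); split=> [x y jxy|x|a].
  + by apply: ij; rewrite -!j'E jxy.
  + split=> [q'x|[k <-]]; last first.
      by apply: (lhom_inj0 ii); rewrite q'E lhomE j'E; apply/f; exists k.
    have [|k jk] := (f (l x)).1; first by rewrite -[q _]q'E q'x lhom0.
    by exists k; apply: il; rewrite j'E.
  + have [y qy] := sq (i a).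
    have [|x lx] := (el y).1; first by rewrite lhomE qy (short_exact0 ip).
    by exists x; apply: ii; rewrite q'E lhomE lx.
(* Conversely Q * P covers B, the section [s] taking care of P, again with kernel K. *)
- move=> K Q j q PQ [ij f sq].
  have PQP := projective_ext (short_exact_prod Q P) PQ PP.
  apply: (H K _ (lhom_comp (lhom_inl Q P) j) (lhom_copair (lhom_comp i q) s) PQP).
  split=> [x y [/ij] //|[y x]|b].
  + split=> [/= e0|[k [<- <-]]]; last first.
      have -> : lhom_copair (lhom_comp i q) s (j k, 0) = i (q (j k)) + s 0 by [].
      have -> : q (j k) = 0 by apply/f; exists k.
      by rewrite !lhom0 addr0.
    have := congr1 p e0; rewrite lhomD (short_exact0 ip) add0r ps lhom0 => x0.
    move: e0; rewrite x0 lhom0 addr0 => /(lhom_inj0 ii) /f[k jk].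
    by exists k; congr pair.
  + by have [y qy] := sq (r b); exists (y, p b); rewrite /= qy rs.
Qed.

Lemma perp_projective n P : projective_module P -> perp n P.
Proof.
elim: n P => [|n IH] P PP; first by split=> //; exact: ext1_projective.
split; first exact: ext1_projective.
by move=> K Q i p PQ ip; apply: IH; exact: projective_ker ip PQ PP.
Qed.

(* Schanuel's lemma: both kernels are, up to a projective summand, the pullback
   of the two presentations. *)
Lemma perp_schanuel n M K P (i : lhom K P) (p : lhom P M) K' P' (i' : lhom K' P')
    (p' : lhom P' M) :
  short_exact i p -> projective_module P ->
  short_exact i' p' -> projective_module P' -> perp n K -> perp n K'.
Proof.
have half : forall K P (i : lhom K P) (p : lhom P M) P' (p' : lhom P' M) W
    (a : lhom W P) (b : lhom W P'),
    short_exact i p -> surj p' -> projective_module P' ->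
    (forall x, p (a x) = p' (b x)) ->
    (forall x, a x = 0 -> b x = 0 -> x = 0) ->
    (forall u v, p u = p' v -> exists x, a x = u /\ b x = v) ->
    perp n K <-> perp n W.
  move=> {i p i' p' P' K' K P} K P i p P' p' W a b ip sp' PP' ab ab0 ex.
  have [ii e sp] := ip.
  have iab : injective (lhom_pair a b) by apply: lhom_injP => w [/ab0 w0 /w0].
  have [|k kE] := lhom_lift_inj (f := lhom_pair i 0) iab.
    move=> u; have [|w [aw bw]] := ex (i u) 0; first by rewrite lhom0 (short_exact0 ip).
    by exists w; congr pair.
  have ak u : a (k u) = i u by have [] := kE u.
  have bk u : b (k u) = 0 by have [] := kE u.
  apply: (@perp_add_projective n K W P' k b) PP'; split=> [x y kxy|w|y].
  - by apply: ii; rewrite -!ak kxy.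
  - split=> [bw|[u <-] //].
    have [|u iu] := (e (a w)).1; first by rewrite ab bw lhom0.
    by exists u; apply: iab; congr pair; rewrite ?ak ?bk.
  - by have [v pv] := sp (p' y); have [|w [_ bw]] := ex v y; [|exists w].
move=> ip PP ip' PP' perpK; have [W [a [b [ab ab0 ex]]]] := pullback_exists p p'.
have [_ _ sp] := ip; have [_ _ sp'] := ip'.
apply/(half _ _ _ _ _ _ W b a ip' sp PP).
- by move=> x; rewrite ab.
- by move=> x bx ax; exact: ab0.
- by move=> u v uv; have [|x [ax bx]] := ex v u; [rewrite uv|exists x].
exact/(half _ _ _ _ _ _ W a b ip sp' PP').
Qed.

(** By Schanuel's lemma one presentation is enough to verify the condition that [perp] imposes on
    all of them. *)
Lemma perp_step n K P M (i : lhom K P) (p : lhom P M) :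
  short_exact i p -> projective_module P -> ext1_vanishes M -> perp n K ->
  perp n.+1 M.
Proof.
move=> ip PP EM perpK; split=> // K' P' i' p' PP' ip'.
exact: perp_schanuel ip PP ip' PP' perpK.
Qed.

(** One degree is gained: the degrees above 1 come from G by shifting, and degree 1 from the
    extension of functionals along [i]. *)
Lemma perp_coker n G F C (i : lhom G F) (p : lhom F C) :
  short_exact i p -> projective_module F -> dual_surj i -> perp n G -> perp n.+1 C.
Proof.
move=> ip PF di perpG; apply: (perp_step ip PF _ perpG).
exact: ext1_quot ip (ext1_projective PF) di.
Qed.

Hypothesis noeth : noetherian S.

Lemma presentation_exists M : fin_gen M ->
  exists (n : nat) (K : lmodType S) (i : lhom K 'rV[S]_n) (p : lhom 'rV[S]_n M),
    short_exact i p /\ fin_gen K.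
Proof.
move=> /fin_genP[n [p sp]]; have [K [i [ii e]]] := kernel_exists p.
exists n, K, i, p; split=> //; exact: fin_gen_inj_row noeth ii.
Qed.

(* Horseshoe lemma: presentations of A and C add up to one of B, whose kernel is
   an extension of theirs. *)
Lemma perp_ext n A B C (i : lhom A B) (p : lhom B C) :
  fin_gen A -> fin_gen C -> short_exact i p -> perp n A -> perp n C -> perp n B.
Proof.
elim: n A B C i p => [|n IH] A B C i p fA fC ip pA pC.
  by split=> //; exact: ext1_ext ip (perp_ext1 pA) (perp_ext1 pC).
have [ii e sp] := ip.
have [k [K [j [q [jq fK]]]]] := presentation_exists fA.
have [l [L [j' [q' [jq' fL]]]]] := presentation_exists fC.
have [ij ejq sq] := jq; have [ij' ejq' sq'] := jq'.
have [s ps] := @projective_row S l _ _ p q' sp.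
pose F : lmodType S := ('rV[S]_k * 'rV[S]_l)%type.
pose t : lhom F B := lhom_copair (lhom_comp i q) s.
have st : surj t.
  move=> b; have [y qy] := sq' (p b).
  have [|a ia] := (e (b - s y)).1; first by rewrite lhomB ps qy subrr.
  have [x qx] := sq a; exists (x, y).
  by rewrite -[LHS]/(i (q x) + s y) qx ia subrK.
have PF : projective_module F.
  exact: projective_ext (short_exact_prod _ _) (@projective_row S k) (@projective_row S l).
have [W [u [iu eu]]] := kernel_exists t.
apply: (@perp_step n W F B u t) => //.
  exact: ext1_ext ip (perp_ext1 pA) (perp_ext1 pC).
have pt x : p (t x) = q' x.2.
  rewrite -[t x]/(i (q x.1) + s x.2) lhomD ps.
  by have -> : p (i (q x.1)) = 0; [apply/e; exists (q x.1)|rewrite add0r].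
have [|v vE] := lhom_lift_inj (f := lhom_comp (lhom_snd _ _) u) ij'.
  move=> x; apply/ejq'; rewrite lhomE lhom_sndE -pt.
  by have -> : t (u x) = 0; [apply/eu; exists x|rewrite lhom0].
have [|k' k'E] := lhom_lift_inj (f := lhom_comp (lhom_inl _ _) j) iu.
  move=> x; apply/eu; rewrite -[LHS]/(i (q (j x)) + s 0).
  by have -> : q (j x) = 0; [apply/ejq; exists x|rewrite !lhom0 addr0].
apply: (IH K W L k' v) => //.
- split=> [x y kxy|w|y].
  + apply: ij; have := k'E x; rewrite kxy k'E => -[] //.
  + split=> [vw|[x <-]]; last first.
      by apply: (lhom_inj0 ij'); rewrite vE lhomE k'E lhom_sndE.
    have uw2 : (u w).2 = 0 by rewrite -lhom_sndE -[LHS]vE vw lhom0.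
    have : t (u w) = 0 by apply/eu; exists w.
    rewrite -[LHS]/(i (q (u w).1) + s (u w).2) uw2 lhom0 addr0.
    move=> /(lhom_inj0 ii) /ejq[x jx]; exists x; apply: iu; rewrite k'E.
    by case: (u w) jx uw2 => a b /= <- ->.
  (* The element s (j' y) need not vanish in B, but it lies in the image of A; a lift x of it to the
     cover of A supplies the correction -x. *)
  + have [|a ia] := (e (s (j' y))).1.
      by rewrite ps; apply/ejq'; exists y.
    have [x qx] := sq a; have [|w uw] := (eu (- x, j' y)).1.
      by rewrite -[LHS]/(i (q (- x)) + s (j' y)) !lhomN qx ia addNr.
    by exists w; apply: ij'; rewrite vE lhomE uw lhom_sndE.
- exact: perpS pA (@projective_row S k) jq.
- exact: perpS pC (@projective_row S l) jq'.
Qed.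

End Perpendicular.

(** * Comparison with Ext computed from projective resolutions *)

Section Resolutions.
Variable S : comNzRingType.
Implicit Types A B C D K L M N P Q T : lmodType S.

Definition shift_resolution M (Q : projective_resolution M) K
    (a : lhom (res_mod Q 1) K) (sa : surj a) (ea : exact_at (res_d Q 1) a) :
  projective_resolution K :=
  ProjectiveResolution (fun i => @res_proj _ _ Q i.+1) sa ea (fun i => @res_exact _ _ Q i.+1).

(** [ExtS_vanishes i] concerns degree i + 1, so index 0 is Ext^1: a cocycle on P_1 descends to the
    kernel K of the augmentation and then extends over P_0. For a larger index, drop P_0 and apply
    the induction hypothesis to K. *)
Lemma perp_ExtS_vanishes i M : perp i M -> ExtS_vanishes i M S^o.
Proof.
elim: i M => [|i IH] M pM Q.
all: have [K [k [ik ek]]] := kernel_exists (res_aug Q).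
all: have kQ : short_exact k (res_aug Q) by split=> //; exact: res_surj.
all: have [|a aE] := lhom_lift_inj (f := res_d Q 0) ik;
  first by move=> x; apply/ek; apply/(@res_exact0 _ _ Q); exists x.
all: have sa : surj a by
  move=> y; have [|x dx] := (@res_exact0 _ _ Q (k y)).1;
    [exact: short_exact0 kQ y | exists x; apply: ik; rewrite aE].
all: have ea : exact_at (res_d Q 1) a by
  move=> x; split=> [ax|xy];
    [apply/(@res_exact _ _ Q 0); rewrite -aE ax lhom0
    |apply: (lhom_inj0 ik); rewrite aE; exact/(@res_exact _ _ Q 0)].
- move=> phi phid.
  have [|f fE] := @lhom_factor_surj _ _ _ _ a phi sa.
    by move=> x /ea[y <-]; exact: phid.
  have [psi psiE] := perp_ext1 pM kQ f.
  by exists psi => x; rewrite -aE psiE fE.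
- exact: (IH K (perpS pM (@res_proj _ _ Q 0) kQ) (shift_resolution sa ea)).
Qed.

Section Cons.
Variables (K P M : lmodType S) (i : lhom K P) (p : lhom P M).
Hypotheses (ip : short_exact i p) (PP : projective_module P).
Variable Q : projective_resolution K.

(** The resolution Q of K is spliced with the presentation K -> P -> M, the inverse operation to
    dropping the term of degree zero. *)
Definition cons_mod (n : nat) : lmodType S := if n is m.+1 then res_mod Q m else P.

Definition cons_d (n : nat) : lhom (cons_mod n.+1) (cons_mod n) :=
  match n with
  | 0%N => lhom_comp i (res_aug Q)
  | m.+1 => res_d Q m
  end.

Fact cons_proj n : projective_module (cons_mod n).
Proof. by case: n => [|n] //=; exact: res_proj. Qed.

Fact cons_exact0 : exact_at (cons_d 0) p.
Proof.
have [_ e _] := ip; move=> b; split=> [/e[k <-]|[x <-]].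
  by have [x <-] := res_surj Q k; exists x.
exact: (short_exact0 ip).
Qed.

Fact cons_exact n : exact_at (cons_d n.+1) (cons_d n).
Proof.
case: n => [|n]; last exact: res_exact.
have [ii _ _] := ip; move=> x; rewrite /= -(@res_exact0 _ _ Q x).
by split=> [/(lhom_inj0 ii)|->] //; rewrite lhom0.
Qed.

Definition cons_resolution : projective_resolution M :=
  ProjectiveResolution cons_proj (let: And3 _ _ sp := ip in sp) cons_exact0 cons_exact.

End Cons.

Hypothesis noeth : noetherian S.

Record presentation M := Presentation {
  pres_rank : nat;
  pres_ker : lmodType S;
  pres_i : lhom pres_ker 'rV[S]_pres_rank;
  pres_p : lhom 'rV[S]_pres_rank M;
  pres_exact : short_exact pres_i pres_p;
  pres_fg : fin_gen pres_ker }.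

(** Finite generation travels with the module, since the recursion defining [syzygy] needs it to
    choose the next presentation. *)
Definition fg_module := {M : lmodType S | fin_gen M}.

Lemma presentation_inhabited (X : fg_module) : exists _ : presentation (sval X), True.
Proof.
case: X => M fM; have [n [K [i [p [ip fK]]]]] := presentation_exists noeth fM.
by exists (Presentation ip fK).
Qed.

Definition pres (X : fg_module) := sval (cid (presentation_inhabited X)).

Fixpoint syzygy (X : fg_module) (n : nat) : fg_module :=
  if n is m.+1 then exist _ _ (pres_fg (pres (syzygy X m))) else X.

Definition syzygy_d (X : fg_module) n :
    lhom 'rV[S]_(pres_rank (pres (syzygy X n.+1))) 'rV[S]_(pres_rank (pres (syzygy X n))) :=
  lhom_comp (pres_i (pres (syzygy X n))) (pres_p (pres (syzygy X n.+1))).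

Lemma resolution_exists M : fin_gen M -> exists _ : projective_resolution M, True.
Proof.
move=> fM; pose X : fg_module := exist _ M fM.
have ex n := pres_exact (pres (syzygy X n)).
unshelve eexists.
  apply: (@ProjectiveResolution S M _ (syzygy_d X) (pres_p (pres X))) => //.
  - by move=> i; exact: projective_row.
  - by have [] := ex 0.
  - have [_ e _] := ex 0; have [_ _ s] := ex 1.
    move=> b; split=> [/e[k <-]|[x <-]].
      by have [x <-] := s k; exists x.
    exact: (short_exact0 (ex 0)).
  - move=> i; have [ii _ _] := ex i; have [_ e _] := ex i.+1; have [_ _ s] := ex i.+2.
    move=> b; split=> [/(lhom_inj0 ii)/e[k <-]|[x <-]].
      by have [x <-] := s k; exists x.
    apply/eqP; rewrite !lhomE; apply/eqP.
    by rewrite (_ : pres_p _ _ = 0) ?lhom0 //; exact: (short_exact0 (ex i.+1)).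
by [].
Qed.

(** [ExtS_vanishes] speaks only of given resolutions, so suitable ones have to be produced: those
    that begin with a fixed finite presentation of M. Any resolution of the kernel K continues to
    one of M, which transfers vanishing from M to K with a shift of one. *)
Lemma ExtS_vanishes_perp M : fin_gen M -> (forall i, ExtS_vanishes i M S^o) ->
  forall n, perp n M.
Proof.
move=> + + n; elim: n M => [|n IH] M fM EM.
all: have [k [K [i [p [ip fK]]]]] := presentation_exists noeth fM.
all: have PP := @projective_row S k.
all: have E1 : ext1_vanishes M.
(* A functional f on K, composed with the augmentation of a resolution of K, is a cocycle for M;
   writing it as a coboundary extends f to the free module. *)
1,3: apply: (ext1_quot ip (ext1_projective PP)) => f;
  have [Q _] := resolution_exists fK;
  have [x|psi psiE] := EM 0%N (cons_resolution ip PP Q) (lhom_comp f (res_aug Q));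
  [ by rewrite !lhomE (_ : res_aug Q _ = 0) ?lhom0 //; apply/(@res_exact0 _ _ Q); exists x
  | by exists psi => y; have [x <-] := res_surj Q y; rewrite -[LHS]psiE].
- by [].
- apply: (perp_step ip PP E1); apply: IH fK _ => j Q.
  exact: (EM j.+1 (cons_resolution ip PP Q)).
Qed.

(** * Gorenstein projective modules *)

Lemma gorenstein_projectiveP M : gorenstein_projective M <->
  [/\ fin_gen M, forall n, perp n M, forall n, perp n (dual M)
    & bijective (@biduality S M)].
Proof.
split=> -[fM EM Ed bM]; split=> //.
- exact: ExtS_vanishes_perp.
- by apply: ExtS_vanishes_perp => //; exact: fin_gen_dual.
- by move=> i; exact: perp_ExtS_vanishes.
- by move=> i; exact: perp_ExtS_vanishes.
Qed.

Lemma dual_map_linear A B (f : lhom A B) :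
  linear (fun g : dual B => lhom_comp g f : dual A).
Proof. by move=> r g h; exact: lhom_ext. Qed.

Definition dual_map A B (f : lhom A B) : lhom (dual B) (dual A) :=
  mk_lhom (dual_map_linear f).

Lemma dual_short_exact A B C (i : lhom A B) (p : lhom B C) :
  short_exact i p -> dual_surj i -> short_exact (dual_map p) (dual_map i).
Proof.
move=> ip di; have [ii e sp] := ip; split.
- apply: lhom_injP => f f0; apply: lhom_ext => c; have [b <-] := sp c.
  exact: (congr1 (fun g : dual B => g b) f0).
- move=> f; split=> [fi|[g <-]]; last first.
    by apply: lhom_ext => a; rewrite /= (short_exact0 ip) lhom0.
  have [|g gE] := @lhom_factor_surj _ _ _ _ p f sp.
    by move=> b /e[a <-]; exact: (congr1 (fun g : dual A => g a) fi).
  by exists g; apply: lhom_ext.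
- by move=> f; have [g gE] := di f; exists g; apply: lhom_ext.
Qed.

Lemma bij_biduality A : (forall a, (forall f : dual A, f a = 0) -> a = 0) ->
  (forall xi : dual (dual A), exists a, forall f, xi f = f a) ->
  bijective (@biduality S A).
Proof.
move=> inj0 ex; have lb : linear (@biduality S A).
  by move=> r a b; apply: lhom_ext => f; rewrite /= lhom_lin.
have [g gE] := choice ex.
have gK : cancel g (@biduality S A) by move=> xi; apply: lhom_ext => f; rewrite [RHS]gE.
exists g => // a; apply/eqP; rewrite -subr_eq0; apply/eqP/inj0 => f.
rewrite lhomB; apply/eqP; rewrite subr_eq0; apply/eqP.
exact: (congr1 (fun xi : dual (dual A) => xi f) (gK (biduality a))).
Qed.

Lemma biduality0 A : bijective (@biduality S A) ->
  forall a, (forall f : dual A, f a = 0) -> a = 0.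
Proof.
move=> /bij_inj bA a f0; apply: bA; apply: lhom_ext => f.
by rewrite [LHS]f0 [RHS](lhom0 f).
Qed.

Lemma biduality_surj A : bijective (@biduality S A) ->
  forall xi : dual (dual A), exists a, forall f, xi f = f a.
Proof. by move=> [g _ gK] xi; exists (g xi) => f; rewrite -[in LHS](gK xi). Qed.

Lemma fg_projective_gp M : fg_projective M -> gorenstein_projective M.
Proof.
move=> PM; apply/gorenstein_projectiveP; split; first by case: PM.
- by move=> n; apply: perp_projective; case: PM.
- by move=> n; apply: perp_projective; case: (fg_projective_dual PM).
- exact: fg_projective_biduality.
Qed.

(** Since Ext^1(C, S) = 0 the dual sequence is again exact, so the Ext conditions follow from
    closure of [perp] under extensions, for the sequence and for its dual. Reflexivity is the five
    lemma for the bidual sequence, done on elements. *)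
Lemma gp_ext A B C (i : lhom A B) (p : lhom B C) : short_exact i p ->
  gorenstein_projective A -> gorenstein_projective C -> gorenstein_projective B.
Proof.
move=> ip /gorenstein_projectiveP[fA pA dA bA] /gorenstein_projectiveP[fC pC dC bC].
have di := perp_ext1 (pC 0%N) ip.
have ed := dual_short_exact ip di; have [id' ed' sd] := ed.
have [ii e sp] := ip.
apply/gorenstein_projectiveP; split.
- exact: fin_gen_ext ip fA fC.
- by move=> n; exact: (perp_ext noeth fA fC ip).
- by move=> n; apply: (perp_ext noeth _ _ ed) => //; exact: fin_gen_dual.
apply: bij_biduality => [b fb|xi].
  have /e[a ia] : p b = 0 by apply: biduality0 => // f; exact: (fb (lhom_comp f p)).
  rewrite -ia (_ : a = 0) ?lhom0 //; apply: biduality0 => // f.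
  by have [g <-] := di f; rewrite ia.
have [c cE] := biduality_surj bC (lhom_comp xi (dual_map p)).
have [b pb] := sp c.
(* On functionals coming from C, xi is evaluation at c = p b. Hence xi minus evaluation at b
   descends to the dual of A, where it is evaluation at some a. *)
have [|eta etaE] := @lhom_factor_surj _ _ _ _ (dual_map i) (xi - biduality b) sd.
  move=> f /ed'[g <-]; rewrite !lhomE [xi _](cE g) -pb; exact: subrr.
have [a aE] := biduality_surj bA eta.
exists (i a + b) => f; rewrite lhomD.
have := etaE f; rewrite aE !lhomE /= => ->; by rewrite subrK.
Qed.

(** The Ext conditions on K are a shift of those on G. On the dual side, the dual of K is the
    cokernel of the dual of G in the dual of F, so [perp_coker] applies. *)
Lemma gp_ker K F G (i : lhom K F) (p : lhom F G) : short_exact i p ->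
  fg_projective F -> gorenstein_projective G -> gorenstein_projective K.
Proof.
move=> ip PF /gorenstein_projectiveP[fG pG dG bG].
have di := perp_ext1 (pG 0%N) ip.
have ed := dual_short_exact ip di; have [id' ed' sd] := ed.
have [ii e sp] := ip; have bF := fg_projective_biduality PF.
apply/gorenstein_projectiveP; split.
- by case: PF => fF _; exact: fin_gen_inj noeth ii fF.
- by move=> n; case: PF => _ PF; exact: (perpS (pG n.+1) PF ip).
- move=> n; have [_ PdF] := fg_projective_dual PF.
  (* By reflexivity of G a functional on its dual is evaluation at some p x; evaluation at x extends
     it to the dual of F. *)
  have E : dual_surj (dual_map p).
    move=> xi; have [g gE] := biduality_surj bG xi; have [x px] := sp g.
    by exists (biduality x) => f; rewrite gE -px.
  by case: n => [|n]; [have [] := perp_coker ed PdF E (dG 0%N)|exact: (perp_coker ed)].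
apply: bij_biduality => [k fk|xi].
  apply: (lhom_inj0 ii); apply: biduality0 => // f; exact: (fk (lhom_comp f i)).
have [x xE] := biduality_surj bF (lhom_comp xi (dual_map i)).
have /e[k ik] : p x = 0.
  apply: biduality0 => // f.
  rewrite -[LHS](xE (lhom_comp f p)) lhomE (_ : dual_map i _ = 0) ?lhom0 //.
  by apply/ed'; exists f.
exists k => f; have [g <-] := sd f; exact: etrans (xE g) (congr1 g (esym ik)).
Qed.

(** Mirror image of the previous lemma: now the Ext conditions on C come from [perp_coker], and
    those on its dual from the dual of C being a syzygy of the dual of G. *)
Lemma gp_coker G F C (i : lhom G F) (p : lhom F C) : short_exact i p ->
  fg_projective F -> dual_surj i -> gorenstein_projective G -> gorenstein_projective C.
Proof.
move=> ip PF di /gorenstein_projectiveP[fG pG dG bG].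
have ed := dual_short_exact ip di; have [id' ed' sd] := ed.
have [ii e sp] := ip; have bF := fg_projective_biduality PF.
apply/gorenstein_projectiveP; split.
- by case: PF => fF _; exact: fin_gen_surj sp fF.
- move=> n; have [_ PF'] := PF.
  by case: n => [|n]; [have [] := perp_coker ip PF' di (pG 0%N)|exact: (perp_coker ip)].
- by move=> n; have [_ PdF] := fg_projective_dual PF; exact: (perpS (dG n.+1) PdF ed).
apply: bij_biduality => [c fc|xi].
  have [x px] := sp c; rewrite -px.
  have [|eta etaE] := @lhom_factor_surj _ _ _ _ (dual_map i) (biduality x) sd.
    by move=> f /ed'[g <-]; rewrite -[RHS](fc g) -px.
  have [g gE] := biduality_surj bG eta.
  have -> : x = i g; last exact: (short_exact0 ip).
  apply/eqP; rewrite -subr_eq0; apply/eqP; apply: biduality0 => // f.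
  rewrite lhomB; apply/eqP; rewrite subr_eq0; apply/eqP.
  exact: etrans (esym (etaE f)) (gE _).
(* Ext^1 of the dual of G vanishes, so xi extends from the dual of C to the dual of F, where it is
   evaluation at some x. *)
have [xi' xi'E] := perp_ext1 (dG 0%N) ed xi.
have [x xE] := biduality_surj bF xi'.
by exists (p x) => f; rewrite -xi'E xE.
Qed.

(** Generators of the dual serve as coordinates: they separate points because G is reflexive, and
    every functional is a combination of them, hence extends to the free module. *)
Lemma gp_embed G : gorenstein_projective G ->
  exists (n : nat) (j : lhom G 'rV[S]_n), injective j /\ dual_surj j.
Proof.
move=> [fG _ _ bG]; have [n [s gs]] := fin_gen_dual noeth fG.
exists n, (coords s); split=> [|f].
  apply: lhom_injP => a /rowP a0; apply: biduality0 => // f; have [c ->] := gs f.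
  by rewrite dual_sum big1 // => i _; have := a0 i; rewrite coordsE mxE => ->; rewrite mulr0.
have [c ->] := gs f; pose x i : S^o := c i.
by exists (comb x) => a; rewrite dual_sum; apply: eq_bigr => i _; rewrite coordsE; exact: mulrC.
Qed.

(** Extending a dual basis of G to functionals on F gives a retraction of [i], so C is a summand of
    F. *)
Lemma fg_projective_coker G F C (i : lhom G F) (p : lhom F C) : short_exact i p ->
  fg_projective F -> dual_surj i -> fg_projective G -> fg_projective C.
Proof.
move=> ip [fF PF] di /dual_basisP[k [x [s xs]]]; have [ii e sp] := ip.
split; first exact: fin_gen_surj sp fF.
have [g gE] := choice (fun t => di (s t)).
pose r := lhom_comp (comb x) (coords g).
have ri a : r (i a) = a.
  by rewrite [RHS]xs; apply: eq_bigr => t _; rewrite coordsE gE.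
have [|t tE] := @lhom_factor_surj _ _ _ _ p (lhom_id F - lhom_comp i r) sp.
  by move=> b /e[a <-]; rewrite lhom_addE lhom_oppE lhom_idE lhom_compE ri subrr.
apply: (@projective_retract _ F _ t p) PF => c; have [b <-] := sp c.
by rewrite tE lhom_addE lhom_oppE lhom_idE lhom_compE lhomB (short_exact0 ip) subr0.
Qed.

Lemma fg_projective_ext A B C (i : lhom A B) (p : lhom B C) : short_exact i p ->
  fg_projective A -> fg_projective C -> fg_projective B.
Proof.
move=> ip [fA PA] [fC PC]; split; first exact: fin_gen_ext ip fA fC.
exact: projective_ext ip PA PC.
Qed.

Lemma fg_projective_ker A B C (i : lhom A B) (p : lhom B C) : short_exact i p ->
  fg_projective B -> fg_projective C -> fg_projective A.
Proof.
move=> ip [fB PB] [fC PC]; split; first exact: fin_gen_projective_ker ip fB PC.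
exact: projective_ker ip PB PC.
Qed.

(* Surjectivity on duals in [fc_coker] and [fc_embed] stands for
   Ext^1(C, S) = 0 for the cokernel C. *)
Record frobenius_class (Y : lmodType S -> Prop) : Prop := FrobeniusClass {
  fc_fg : forall M, Y M -> fin_gen M;
  fc_proj : forall M, fg_projective M -> Y M;
  fc_ext : forall A B C (i : lhom A B) (p : lhom B C),
    short_exact i p -> Y A -> Y C -> Y B;
  fc_ker : forall A B C (i : lhom A B) (p : lhom B C),
    short_exact i p -> fg_projective B -> Y C -> Y A;
  fc_coker : forall A B C (i : lhom A B) (p : lhom B C),
    short_exact i p -> fg_projective B -> dual_surj i -> Y A -> Y C;
  fc_embed : forall M, Y M ->
    exists (n : nat) (j : lhom M 'rV[S]_n), injective j /\ dual_surj j;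
  fc_ext1 : forall M, Y M -> ext1_vanishes M }.

Lemma frobenius_class_gp : frobenius_class (@gorenstein_projective S).
Proof.
split.
- by move=> M [].
- exact: fg_projective_gp.
- exact: gp_ext.
- exact: gp_ker.
- exact: gp_coker.
- exact: gp_embed.
- by move=> M /gorenstein_projectiveP[_ pM _ _]; exact: perp_ext1 (pM 0%N).
Qed.

Lemma frobenius_class_fg_projective : frobenius_class (@fg_projective S).
Proof.
split=> //.
- by move=> M [].
- exact: fg_projective_ext.
- exact: fg_projective_ker.
- exact: fg_projective_coker.
- by move=> M /fg_projective_gp; exact: gp_embed.
- by move=> M [_]; exact: ext1_projective.
Qed.

End Resolutions.

(** * Exact structure on factorizations *)

Section ShortExact.
Variable S : comNzRingType.
Implicit Types A B C D K L M N P Q R T Z : lmodType S.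

Lemma short_exact_ker A B (p : lhom A B) : surj p ->
  exists (K : lmodType S) (i : lhom K A), short_exact i p.
Proof. by move=> sp; have [K [i [ii e]]] := kernel_exists p; exists K, i. Qed.

Lemma short_exact_coker A B (i : lhom A B) : injective i ->
  exists (C : lmodType S) (p : lhom B C), short_exact i p.
Proof. by move=> ii; have [C [p [sp e]]] := cokernel_exists i; exists C, p. Qed.

Lemma short_exact_iso A B C A' B' C' (i : lhom A B) (p : lhom B C)
    (i' : lhom A' B') (p' : lhom B' C') (a : lhom A A') (b : lhom B B') (c : lhom C C') :
  surj a -> bijective b -> bijective c ->
  (forall x, i' (a x) = b (i x)) -> (forall y, p' (b y) = c (p y)) ->
  short_exact i p -> short_exact i' p'.
Proof.
move=> sa [b' b'K bK] [c' c'K cK] ia pb ip; have [ii e sp] := ip.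
have b0 := lhom_inj0 (can_inj b'K); have c0 := lhom_inj0 (can_inj c'K).
split=> [|y'|z'].
- apply: lhom_injP => x'; have [x <-] := sa x'.
  by rewrite ia => /b0 /(lhom_inj0 ii) ->; rewrite lhom0.
- split=> [|[x' <-]].
    by rewrite -[y']bK pb => /c0 /e[x <-]; exists (a x); exact: ia.
  by have [x <-] := sa x'; rewrite ia pb (short_exact0 ip) lhom0.
- by have [y py] := sp (c' z'); exists (b y); rewrite pb py cK.
Qed.

Lemma short_exact_id_r A Z : (forall z : Z, z = 0) -> short_exact (lhom_id A) (0 : lhom A Z).
Proof.
move=> Z0; split=> // [x|z]; last by exists 0; rewrite [RHS]Z0.
by split=> // _; exists x.
Qed.

Lemma short_exact_id_l A Z : (forall z : Z, z = 0) -> short_exact (0 : lhom Z A) (lhom_id A).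
Proof.
move=> Z0; split=> [x y _|x|x]; first by rewrite (Z0 x) (Z0 y).
  by split=> [x0|[z <-]] //; exists 0; exact: esym.
by exists x.
Qed.

(** Parallel sides of a pushout square have the same cokernel. The pushout C is thus an extension of
    Z by A', which keeps it in any extension-closed class. *)
Lemma short_exact_pushout A B Z A' C (i : lhom A B) (p : lhom B Z) (f : lhom A A')
    (q : lhom (B * A')%type C) :
  short_exact i p -> short_exact (lhom_pair i f) q ->
  exists z : lhom C Z, short_exact (lhom_comp q (lhom_inr B A')) z.
Proof.
move=> ip [ik e sq]; have [ii ei sp] := ip.
have [|z zE] := lhom_factor_surj (f := lhom_comp p (lhom_fst B A')) sq.
  by move=> b /e[a <-]; rewrite lhomE lhom_fstE (short_exact0 ip).
exists z; split=> [|c|x].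
- apply: lhom_injP => a' /e[a [ia <-]].
  by rewrite (lhom_inj0 ii ia) lhom0.
- split=> [|[a' <-]]; last by rewrite lhomE zE lhomE lhom_fstE /= lhom0.
  have [[b a'] <-] := sq c; rewrite zE lhomE lhom_fstE => /ei[a ia].
  exists (a' - f a).
  have -> : (b, a') = lhom_pair i f a + (0, a' - f a).
    by congr pair; rewrite /= ?addr0 ?ia // addrC subrK.
  rewrite [RHS]lhomD; have -> : q (lhom_pair i f a) = 0 by apply/e; exists a.
  by rewrite add0r.
- by have [b pb] := sp x; exists (q (b, 0)); rewrite zE lhomE lhom_fstE.
Qed.

Lemma short_exact_pullback A B Z Z' K (i : lhom A B) (p : lhom B Z) (f : lhom Z' Z)
    (k : lhom K (B * Z')%type) :
  short_exact i p -> short_exact k (lhom_copair p f) ->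
  exists j : lhom A K, short_exact j (lhom_comp (lhom_snd B Z') k).
Proof.
move=> ip [ik e _]; have [ii ei sp] := ip.
have [|j jE] := lhom_lift_inj (f := lhom_comp (lhom_inl B Z') i) ik.
  by move=> a; apply/e; rewrite /= (short_exact0 ip) lhom0 addr0.
exists j; split=> [|x|z].
- apply: lhom_injP => a ja; apply: (lhom_inj0 ii).
  by have := jE a; rewrite ja lhom0 => -[].
- split=> [|[a <-]]; last by rewrite lhomE jE lhom_sndE.
  rewrite lhomE lhom_sndE => kx2.
  have : lhom_copair p f (k x) = 0 by apply/e; exists x.
  rewrite /= kx2 lhom0 addr0 => /ei[a ia]; exists a; apply: ik.
  by rewrite jE; case: (k x) ia kx2 => ? ? /= <- ->.
- have [b pb] := sp (- f z); have [|x kx] := (e (b, z)).1.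
    by rewrite /= pb addNr.
  by exists x; rewrite lhomE kx lhom_sndE.
Qed.

(** The third isomorphism theorem: C/A is an extension of C/B by B/A. This is how composites of
    inflations remain inflations. *)
Lemma short_exact_comp_inj A B C P Q R (i : lhom A B) (p : lhom B P)
    (j : lhom B C) (q : lhom C Q) (r : lhom C R) :
  short_exact i p -> short_exact j q -> short_exact (lhom_comp j i) r ->
  exists (u : lhom P R) (v : lhom R Q), short_exact u v.
Proof.
move=> ip jq jir; have [ii ei sp] := ip; have [ij ej sq] := jq.
have [iji er sr] := jir.
have [|u uE] := lhom_factor_surj (f := lhom_comp r j) sp.
  by move=> b /ei[a <-]; exact: (short_exact0 jir).
have [|v vE] := lhom_factor_surj (f := q) sr.
  by move=> c /er[a <-]; rewrite lhomE (short_exact0 jq).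
exists u, v; split=> [|x|z].
- apply: lhom_injP => x; have [b <-] := sp x; rewrite uE => /er[a /ij <-].
  exact: short_exact0 ip a.
- split=> [|[y <-]].
    have [c <-] := sr x; rewrite vE => /ej[b <-]; exists (p b); exact: uE.
  by have [b <-] := sp y; rewrite uE lhomE vE (short_exact0 jq).
- by have [c qc] := sq z; exists (r c); rewrite vE.
Qed.

Lemma short_exact_comp_surj A B C K L N (i : lhom K A) (p : lhom A B)
    (j : lhom L B) (q : lhom B C) (k : lhom N A) :
  short_exact i p -> short_exact j q -> short_exact k (lhom_comp q p) ->
  exists (u : lhom K N) (v : lhom N L), short_exact u v.
Proof.
move=> ip jq kqp; have [ii ei sp] := ip; have [ij ej sq] := jq.
have [ik ek _] := kqp.
have [|u uE] := lhom_lift_inj (f := i) ik.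
  by move=> x; apply/ek; rewrite lhomE (short_exact0 ip) lhom0.
have [|v vE] := lhom_lift_inj (f := lhom_comp p k) ij.
  by move=> x; apply/ej; exact: (short_exact0 kqp).
exists u, v; split=> [x y uxy|x|y].
- by apply: ii; rewrite -!uE uxy.
- split=> [vx|[y <-]].
    have [|y iy] := (ei (k x)).1; first by have := vE x; rewrite vx lhom0.
    by exists y; apply: ik; rewrite uE.
  by apply: (lhom_inj0 ij); rewrite vE lhomE uE (short_exact0 ip).
- have [a pa] := sp (j y); have [|x kx] := (ek a).1.
    by rewrite lhomE pa (short_exact0 jq).
  by exists x; apply: ij; rewrite vE lhomE kx.
Qed.

Lemma ext1_extend_row A B C (i : lhom A B) (p : lhom B C) n (f : lhom A 'rV[S]_n) :
  short_exact i p -> ext1_vanishes C -> exists g : lhom B 'rV[S]_n, forall a, g (i a) = f a.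
Proof.
move=> ip EC.
have lc t : linear (fun a => f a 0 t : S^o) by move=> r u v; rewrite lhom_lin !mxE.
have [g gE] := choice (fun t => EC _ _ _ _ ip (mk_lhom (lc t))).
by exists (coords g) => a; apply/rowP => t; rewrite coordsE gE.
Qed.

End ShortExact.

(** * Retracts, pushouts and pullbacks in a preadditive category *)

Section Preadditive.
Variable E : exact_data.

Lemma projective_retract_obj (P Q : E) (s : hom P Q) (r : hom Q P) :
  r \oc s = idm P -> projective_obj Q -> projective_obj P.
Proof.
move=> rs PQ Y Z p f dp; have [g gE] := PQ _ _ p (f \oc r) dp.
by exists (g \oc s); rewrite compmA gE -compmA rs compm1.
Qed.

Lemma injective_retract_obj (P Q : E) (s : hom P Q) (r : hom Q P) :
  r \oc s = idm P -> injective_obj Q -> injective_obj P.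
Proof.
move=> rs IQ X Y i f di; have [g gE] := IQ _ _ i (s \oc f) di.
by exists (r \oc g); rewrite -compmA gE compmA rs comp1m.
Qed.

Lemma cokernel_pushout (X Y X' B C : E) (i : hom X Y) (f : hom X X')
    (i1 : hom Y B) (i2 : hom X' B) (p1 : hom B Y) (p2 : hom B X') (q : hom B C) :
  is_biproduct i1 i2 p1 p2 -> is_cokernel (i1 \oc i - i2 \oc f) q ->
  is_pushout i f (q \oc i2) (q \oc i1).
Proof.
move=> [e11 e22 e12 e21 eB] [q0 uq]; split=> [|T a b ab].
  apply/eqP; rewrite eq_sym -subr_eq0 -!compmA -compmBr q0 //.
have [|c [cE cU]] := uq T (b \oc p1 + a \oc p2).
  rewrite compmDl !compmBr -!compmA !(compmA p1) !(compmA p2) e11 e22 e12 e21.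
  by rewrite !comp1m !compm0l !compm0r subr0 sub0r ab subrr.
exists c; split.
  rewrite !compmA cE !compmDl -!compmA e11 e22 e12 e21.
  by rewrite !compm0r !compm1 add0r addr0.
move=> c' [c1 c2]; apply: cU.
by rewrite -c1 -c2 -!compmA -!compmDr eB compm1.
Qed.

Lemma kernel_pullback (Y Z Z' B K : E) (p : hom Y Z) (f : hom Z' Z)
    (i1 : hom Y B) (i2 : hom Z' B) (p1 : hom B Y) (p2 : hom B Z') (k : hom K B) :
  is_biproduct i1 i2 p1 p2 -> is_kernel k (p \oc p1 - f \oc p2) ->
  is_pullback p f (p2 \oc k) (p1 \oc k).
Proof.
move=> [e11 e22 e12 e21 eB] [k0 uk]; split=> [|T a b ab].
  by apply/eqP; rewrite eq_sym -subr_eq0 !compmA -compmBl k0.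
have [|c [cE cU]] := uk T (i1 \oc b + i2 \oc a).
  rewrite compmDr !compmBl -!compmA !(compmA p1) !(compmA p2) e11 e22 e12 e21.
  by rewrite !comp1m !compm0l !compm0r subr0 sub0r ab subrr.
exists c; split.
  rewrite -!compmA cE !compmDr !compmA e11 e22 e12 e21.
  by rewrite !compm0l !comp1m add0r addr0.
move=> c' [c1 c2]; apply: cU.
by rewrite -c1 -c2 !compmA -!compmDl eB comp1m.
Qed.

End Preadditive.

(** * Factorizations with entries in a Frobenius class *)

Section Factorizations.
Variables (S : comNzRingType) (w : S) (X Y : lmodType S -> Prop).
Hypotheses (YX : forall M, Y M -> X M) (FY : frobenius_class Y).

(** For [Y := fg_projective] this is [in_MF_P] up to conversion; for [Y := X] it holds of every
    object. *)
Definition mf_in (A : MF w X) : Prop := Y (mf1 A) /\ Y (mf0 A).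

Local Notation E := (full_subcategory mf_in).

Definition mk_obj (M1 M0 : lmodType S) (g1 : lhom M1 M0) (g0 : lhom M0 M1)
    (Y1 : Y M1) (Y0 : Y M0) (e1 : forall x, g1 (g0 x) = w *: x)
    (e0 : forall x, g0 (g1 x) = w *: x) : E :=
  exist mf_in (MatFact (YX Y1) (YX Y0) e1 e0) (conj Y1 Y0).

Definition mk_hom (A B : E) (f1 : lhom (mf1 (sval A)) (mf1 (sval B)))
    (f0 : lhom (mf0 (sval A)) (mf0 (sval B)))
    (c1 : forall x, mf_g1 (sval B) (f1 x) = f0 (mf_g1 (sval A) x))
    (c0 : forall x, mf_g0 (sval B) (f0 x) = f1 (mf_g0 (sval A) x)) : hom A B :=
  @mk_mf_hom S w X (sval A) (sval B) f1 f0 (conj c1 c0).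

Definition hom1 (A B : E) (f : hom A B) : lhom (mf1 (sval A)) (mf1 (sval B)) :=
  @phi1 S w X (sval A) (sval B) f.

Definition hom0 (A B : E) (f : hom A B) : lhom (mf0 (sval A)) (mf0 (sval B)) :=
  @phi0 S w X (sval A) (sval B) f.

Lemma homg1 (A B : E) (f : hom A B) x :
  mf_g1 (sval B) (hom1 f x) = hom0 f (mf_g1 (sval A) x).
Proof. by have [+ _] := @mf_homP S w X (sval A) (sval B) f; exact. Qed.

Lemma homg0 (A B : E) (f : hom A B) x :
  mf_g0 (sval B) (hom0 f x) = hom1 f (mf_g0 (sval A) x).
Proof. by have [_] := @mf_homP S w X (sval A) (sval B) f; exact. Qed.

Lemma hom_ext (A B : E) (f g : hom A B) : hom1 f =1 hom1 g -> hom0 f =1 hom0 g -> f = g.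
Proof. exact: mf_hom_ext. Qed.

Lemma mk_hom1 (A B : E) f1 f0 c1 c0 : hom1 (@mk_hom A B f1 f0 c1 c0) = f1.
Proof. by []. Qed.

Lemma mk_hom0 (A B : E) f1 f0 c1 c0 : hom0 (@mk_hom A B f1 f0 c1 c0) = f0.
Proof. by []. Qed.

Lemma hom1M (A B C : E) (g : hom B C) (f : hom A B) x : hom1 (g \oc f) x = hom1 g (hom1 f x).
Proof. by []. Qed.

Lemma hom0M (A B C : E) (g : hom B C) (f : hom A B) x : hom0 (g \oc f) x = hom0 g (hom0 f x).
Proof. by []. Qed.

Lemma hom1D (A B : E) (f g : hom A B) x : hom1 (f + g) x = hom1 f x + hom1 g x.
Proof. by []. Qed.

Lemma hom0D (A B : E) (f g : hom A B) x : hom0 (f + g) x = hom0 f x + hom0 g x.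
Proof. by []. Qed.

Lemma hom1N (A B : E) (f : hom A B) x : hom1 (- f) x = - hom1 f x.
Proof. by []. Qed.

Lemma hom0N (A B : E) (f : hom A B) x : hom0 (- f) x = - hom0 f x.
Proof. by []. Qed.

Lemma hom1_id (A : E) x : hom1 (idm A) x = x.
Proof. by []. Qed.

Lemma hom0_id (A : E) x : hom0 (idm A) x = x.
Proof. by []. Qed.

Lemma hom1_0 (A B : E) x : hom1 (0 : hom A B) x = 0.
Proof. by []. Qed.

Lemma hom0_0 (A B : E) x : hom0 (0 : hom A B) x = 0.
Proof. by []. Qed.

Definition homE := (hom1M, hom0M, hom1D, hom0D, hom1N, hom0N, hom1_id, hom0_id,
  hom1_0, hom0_0, mk_hom1, mk_hom0).

Lemma mf_eq1 (A : E) x : mf_g1 (sval A) (mf_g0 (sval A) x) = w *: x.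
Proof. exact: mf_g1g0. Qed.

Lemma mf_eq0 (A : E) x : mf_g0 (sval A) (mf_g1 (sval A) x) = w *: x.
Proof. exact: mf_g0g1. Qed.

Lemma confl_is_kernel (A B C : E) (i : hom A B) (p : hom B C) : confl i p -> is_kernel i p.
Proof.
move=> [se1 se0]; have [i1 e1 _] := se1; have [i0 e0 _] := se0.
split=> [|T f pf].
  by apply: hom_ext => x; [exact: short_exact0 se1 x|exact: short_exact0 se0 x].
have [|g1 g1E] := lhom_lift_inj (f := hom1 f) i1.
  by move=> x; apply/e1; exact: (congr1 (fun h => hom1 h x) pf).
have [|g0 g0E] := lhom_lift_inj (f := hom0 f) i0.
  by move=> x; apply/e0; exact: (congr1 (fun h => hom0 h x) pf).
have c1 x : mf_g1 (sval A) (g1 x) = g0 (mf_g1 (sval T) x).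
  by apply: i0; rewrite g0E -!homg1 g1E.
have c0 x : mf_g0 (sval A) (g0 x) = g1 (mf_g0 (sval T) x).
  by apply: i1; rewrite g1E -!homg0 g0E.
exists (@mk_hom T A g1 g0 c1 c0); split; first by apply: hom_ext => x; [exact: g1E|exact: g0E].
move=> g gE; apply: hom_ext => x.
  by apply: i1; rewrite [LHS]g1E -gE.
by apply: i0; rewrite [LHS]g0E -gE.
Qed.

Lemma confl_is_cokernel (A B C : E) (i : hom A B) (p : hom B C) :
  confl i p -> is_cokernel i p.
Proof.
move=> [se1 se0]; have [i1 e1 s1] := se1; have [i0 e0 s0] := se0.
split=> [|T f fi].
  by apply: hom_ext => x; [exact: short_exact0 se1 x|exact: short_exact0 se0 x].
have [|g1 g1E] := lhom_factor_surj (f := hom1 f) s1.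
  by move=> x /e1[a <-]; exact: (congr1 (fun h => hom1 h a) fi).
have [|g0 g0E] := lhom_factor_surj (f := hom0 f) s0.
  by move=> x /e0[a <-]; exact: (congr1 (fun h => hom0 h a) fi).
have c1 x : mf_g1 (sval T) (g1 x) = g0 (mf_g1 (sval C) x).
  by have [y <-] := s1 x; rewrite g1E !homg1 g0E.
have c0 x : mf_g0 (sval T) (g0 x) = g1 (mf_g0 (sval C) x).
  by have [y <-] := s0 x; rewrite g0E !homg0 g1E.
exists (@mk_hom C T g1 g0 c1 c0); split; first by apply: hom_ext => x; [exact: g1E|exact: g0E].
move=> g gE; apply: hom_ext => x.
  by have [y <-] := s1 x; rewrite [LHS]g1E -gE.
by have [y <-] := s0 x; rewrite [LHS]g0E -gE.
Qed.

(** Both maps of the factorization pass to the componentwise cokernels, so being an inflation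
    reduces to having these cokernels in [Y]. *)
Lemma inflation_coker (A B : E) (k : hom A B) C1 C0 (q1 : lhom _ C1) (q0 : lhom _ C0) :
  short_exact (hom1 k) q1 -> short_exact (hom0 k) q0 -> Y C1 -> Y C0 ->
  exists (C : E) (q : hom B C), confl k q.
Proof.
move=> se1 se0 Y1 Y0; have [i1 e1 s1] := se1; have [i0 e0 s0] := se0.
have [|g1 g1E] := lhom_factor_surj (f := lhom_comp q0 (mf_g1 (sval B))) s1.
  by move=> x /e1[a <-]; rewrite lhomE homg1 (short_exact0 se0).
have [|g0 g0E] := lhom_factor_surj (f := lhom_comp q1 (mf_g0 (sval B))) s0.
  by move=> x /e0[a <-]; rewrite lhomE homg0 (short_exact0 se1).
have w1 x : g1 (g0 x) = w *: x.
  by have [y <-] := s0 x; rewrite g0E g1E lhomE mf_eq1 lhomZ.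
have w0 x : g0 (g1 x) = w *: x.
  by have [y <-] := s1 x; rewrite g1E g0E lhomE mf_eq0 lhomZ.
by exists (mk_obj Y1 Y0 w1 w0), (@mk_hom B (mk_obj Y1 Y0 w1 w0) q1 q0 g1E g0E).
Qed.

Lemma deflation_ker (B C : E) (p : hom B C) K1 K0 (k1 : lhom K1 _) (k0 : lhom K0 _) :
  short_exact k1 (hom1 p) -> short_exact k0 (hom0 p) -> Y K1 -> Y K0 ->
  exists (K : E) (k : hom K B), confl k p.
Proof.
move=> se1 se0 Y1 Y0; have [i1 e1 s1] := se1; have [i0 e0 s0] := se0.
have [|g1 g1E] := lhom_lift_inj (f := lhom_comp (mf_g1 (sval B)) k1) i0.
  by move=> x; apply/e0; rewrite lhomE -homg1 (short_exact0 se1) lhom0.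
have [|g0 g0E] := lhom_lift_inj (f := lhom_comp (mf_g0 (sval B)) k0) i1.
  by move=> x; apply/e1; rewrite lhomE -homg0 (short_exact0 se0) lhom0.
have w1 x : g1 (g0 x) = w *: x.
  by apply: i0; rewrite g1E lhomE g0E lhomE mf_eq1 lhomZ.
have w0 x : g0 (g1 x) = w *: x.
  by apply: i1; rewrite g0E lhomE g1E lhomE mf_eq0 lhomZ.
have c1 x := esym (g1E x); have c0 x := esym (g0E x).
by exists (mk_obj Y1 Y0 w1 w0), (@mk_hom (mk_obj Y1 Y0 w1 w0) B k1 k0 c1 c0).
Qed.

Lemma Y_zero : Y ('rV[S]_0 : lmodType S).
Proof. by apply: (fc_proj FY); split; [exact: fin_gen_row|exact: projective_row]. Qed.

Lemma row_zero (v : 'rV[S]_0) : v = 0.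
Proof. by apply/rowP => -[]. Qed.

Lemma zero_obj_eq x : (0 : lhom 'rV[S]_0 'rV[S]_0) ((0 : lhom 'rV[S]_0 'rV[S]_0) x) = w *: x.
Proof. by rewrite [LHS]row_zero [RHS]row_zero. Qed.

Definition zero_obj : E := mk_obj Y_zero Y_zero zero_obj_eq zero_obj_eq.

Lemma Y_prod M N : Y M -> Y N -> Y (M * N)%type.
Proof. exact: (fc_ext FY (short_exact_prod M N)). Qed.

Definition lhom_prod (A B C D : lmodType S) (f : lhom A C) (g : lhom B D) :
    lhom (A * B)%type (C * D)%type :=
  lhom_pair (lhom_comp f (lhom_fst A B)) (lhom_comp g (lhom_snd A B)).

Lemma lhom_prodE (A B C D : lmodType S) (f : lhom A C) (g : lhom B D) x :
  lhom_prod f g x = (f x.1, g x.2).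
Proof. by congr pair; rewrite lhomE ?lhom_fstE ?lhom_sndE. Qed.

Lemma prod_eq (M1 M0 N1 N0 : lmodType S) (f1 : lhom M1 M0) (f0 : lhom M0 M1)
    (g1 : lhom N1 N0) (g0 : lhom N0 N1) :
  (forall x, f1 (f0 x) = w *: x) -> (forall x, g1 (g0 x) = w *: x) ->
  forall x, lhom_prod f1 g1 (lhom_prod f0 g0 x) = w *: x.
Proof. by move=> ef eg x; rewrite !lhom_prodE ef eg. Qed.

Definition biprod (A B : E) : E :=
  mk_obj (Y_prod (proj1 (svalP A)) (proj1 (svalP B)))
    (Y_prod (proj2 (svalP A)) (proj2 (svalP B)))
    (prod_eq (mf_eq1 (A := A)) (mf_eq1 (A := B)))
    (prod_eq (mf_eq0 (A := A)) (mf_eq0 (A := B))).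

Section ProdMaps.
Variables (A B C D : lmodType S) (f : lhom A C) (g : lhom B D).

Lemma lhom_prod_inl x : lhom_prod f g (lhom_inl A B x) = lhom_inl C D (f x).
Proof. by rewrite lhom_prodE lhom0. Qed.

Lemma lhom_prod_inr x : lhom_prod f g (lhom_inr A B x) = lhom_inr C D (g x).
Proof. by rewrite lhom_prodE lhom0. Qed.

Lemma lhom_prod_fst x : f (lhom_fst A B x) = lhom_fst C D (lhom_prod f g x).
Proof. by rewrite !lhom_fstE lhom_prodE. Qed.

Lemma lhom_prod_snd x : g (lhom_snd A B x) = lhom_snd C D (lhom_prod f g x).
Proof. by rewrite !lhom_sndE lhom_prodE. Qed.

End ProdMaps.

Definition bi_inl (A B : E) : hom A (biprod A B) :=
  @mk_hom A (biprod A B) (lhom_inl _ _) (lhom_inl _ _) (lhom_prod_inl _ _) (lhom_prod_inl _ _).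

Definition bi_inr (A B : E) : hom B (biprod A B) :=
  @mk_hom B (biprod A B) (lhom_inr _ _) (lhom_inr _ _) (lhom_prod_inr _ _) (lhom_prod_inr _ _).

Definition bi_fst (A B : E) : hom (biprod A B) A :=
  @mk_hom (biprod A B) A (lhom_fst _ _) (lhom_fst _ _) (lhom_prod_fst _ _) (lhom_prod_fst _ _).

Definition bi_snd (A B : E) : hom (biprod A B) B :=
  @mk_hom (biprod A B) B (lhom_snd _ _) (lhom_snd _ _) (lhom_prod_snd _ _) (lhom_prod_snd _ _).

Lemma bi_inl1 A B x : hom1 (bi_inl A B) x = (x, 0).
Proof. by []. Qed.

Lemma bi_inl0 A B x : hom0 (bi_inl A B) x = (x, 0).
Proof. by []. Qed.

Lemma bi_inr1 A B x : hom1 (bi_inr A B) x = (0, x).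
Proof. by []. Qed.

Lemma bi_inr0 A B x : hom0 (bi_inr A B) x = (0, x).
Proof. by []. Qed.

Lemma bi_fst1 A B x : hom1 (bi_fst A B) x = x.1.
Proof. exact: lhom_fstE. Qed.

Lemma bi_fst0 A B x : hom0 (bi_fst A B) x = x.1.
Proof. exact: lhom_fstE. Qed.

Lemma bi_snd1 A B x : hom1 (bi_snd A B) x = x.2.
Proof. exact: lhom_sndE. Qed.

Lemma bi_snd0 A B x : hom0 (bi_snd A B) x = x.2.
Proof. exact: lhom_sndE. Qed.

Definition biE := (bi_inl1, bi_inl0, bi_inr1, bi_inr0, bi_fst1, bi_fst0, bi_snd1, bi_snd0).

Lemma pair_sub (M N : lmodType S) (m : M) (n : N) : (m, 0) - (0, n) = (m, - n).
Proof. by congr pair; rewrite /= ?oppr0 ?addr0 ?add0r. Qed.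

Lemma pair_add (M N : lmodType S) (x : M * N) : (x.1, 0) + (0, x.2) = x.
Proof. by case: x => m n; congr pair; rewrite /= ?addr0 ?add0r. Qed.

Lemma biprod_is_biproduct (A B : E) :
  is_biproduct (bi_inl A B) (bi_inr A B) (bi_fst A B) (bi_snd A B).
Proof.
by split; apply: hom_ext => x; rewrite !homE !biE //; exact: pair_add.
Qed.

Lemma iso_bij (A B : E) (f : hom A B) : is_iso f ->
  bijective (hom1 f) /\ bijective (hom0 f).
Proof.
move=> [g [gf fg]]; split.
  exists (hom1 g) => x; first exact: (congr1 (fun h => hom1 h x) gf).
  exact: (congr1 (fun h => hom1 h x) fg).
exists (hom0 g) => x; first exact: (congr1 (fun h => hom0 h x) gf).
exact: (congr1 (fun h => hom0 h x) fg).
Qed.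

Lemma bij_surj (T U : Type) (f : T -> U) : bijective f -> surj f.
Proof. by move=> [g _ gK] u; exists (g u). Qed.

Lemma sub_inflation_comp (A B C : E) (j : hom B C) (i : hom A B) :
  inflation j -> inflation i -> inflation (j \oc i).
Proof.
move=> [Q [q [jq1 jq0]]] [P [p [ip1 ip0]]].
have coker U V W (k : lhom U V) (l : lhom V W) P' Q' (p' : lhom V P') (q' : lhom W Q') :
    short_exact k p' -> short_exact l q' -> Y P' -> Y Q' ->
    exists R (r : lhom W R), short_exact (lhom_comp l k) r /\ Y R.
  move=> kp lq YP YQ; have [ik _ _] := kp; have [il _ _] := lq.
  have [R [r rE]] := short_exact_coker (inj_comp il ik : injective (lhom_comp l k)).
  have [u [v uv]] := short_exact_comp_inj kp lq rE.
  by exists R, r; split=> //; exact: fc_ext FY _ _ _ _ _ uv YP YQ.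
have [R1 [r1 [e1 YR1]]] := coker _ _ _ _ _ _ _ _ _ ip1 jq1 (proj1 (svalP P)) (proj1 (svalP Q)).
have [R0 [r0 [e0 YR0]]] := coker _ _ _ _ _ _ _ _ _ ip0 jq0 (proj2 (svalP P)) (proj2 (svalP Q)).
exact: (@inflation_coker A C (j \oc i) _ _ _ _ e1 e0 YR1 YR0).
Qed.

Lemma sub_deflation_comp (A B C : E) (q : hom B C) (p : hom A B) :
  deflation q -> deflation p -> deflation (q \oc p).
Proof.
move=> [L [j [jq1 jq0]]] [K [i [ip1 ip0]]].
have ker U V W (k : lhom U V) (l : lhom V W) P' Q' (p' : lhom P' U) (q' : lhom Q' V) :
    short_exact p' k -> short_exact q' l -> Y P' -> Y Q' ->
    exists R (r : lhom R U), short_exact r (lhom_comp l k) /\ Y R.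
  move=> kp lq YP YQ; have [_ _ sk] := kp; have [_ _ sl] := lq.
  have skl : surj (lhom_comp l k).
    by move=> x; have [y <-] := sl x; have [z <-] := sk y; exists z.
  have [R [r rE]] := short_exact_ker skl.
  have [u [v uv]] := short_exact_comp_surj kp lq rE.
  by exists R, r; split=> //; exact: fc_ext FY _ _ _ _ _ uv YP YQ.
have [R1 [r1 [e1 YR1]]] := ker _ _ _ _ _ _ _ _ _ ip1 jq1 (proj1 (svalP K)) (proj1 (svalP L)).
have [R0 [r0 [e0 YR0]]] := ker _ _ _ _ _ _ _ _ _ ip0 jq0 (proj2 (svalP K)) (proj2 (svalP L)).
exact: (@deflation_ker A C (q \oc p) _ _ _ _ e1 e0 YR1 YR0).
Qed.

(** The pushout is the cokernel of (i, -f) into the biproduct. Each component is an extension of one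
    of Z by one of A', hence in [Y], and the new map out of A' has the cokernel Z of [i]. *)
Lemma sub_pushout (A B A' : E) (i : hom A B) (f : hom A A') :
  inflation i -> exists (B' : E) (i' : hom A' B') (f' : hom B B'),
    is_pushout i f i' f' /\ inflation i'.
Proof.
move=> [Z [p [ip1 ip0]]].
pose k : hom A (biprod B A') := bi_inl B A' \oc i - bi_inr B A' \oc f.
have k1 : hom1 k = lhom_pair (hom1 i) (- hom1 f).
  by apply: lhom_ext => x; rewrite !homE biE biE; exact: pair_sub.
have k0 : hom0 k = lhom_pair (hom0 i) (- hom0 f).
  by apply: lhom_ext => x; rewrite !homE biE biE; exact: pair_sub.
have coker U V V' W (u : lhom U V) (v : lhom V W) (g : lhom U V') :
    short_exact u v -> Y V' -> Y W ->
    exists R (r : lhom (V * V')%type R), short_exact (lhom_pair u g) r /\ Y R.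
  move=> uv YV' YW; have [iu _ _] := uv.
  have ik : injective (lhom_pair u g) by move=> x y [/iu].
  have [R [r rE]] := short_exact_coker ik; have [z zE] := short_exact_pushout uv rE.
  by exists R, r; split=> //; exact: fc_ext FY _ _ _ _ _ zE YV' YW.
have [R1 [r1 [e1 YR1]]] := coker _ _ _ _ _ _ (- hom1 f) ip1 (proj1 (svalP A')) (proj1 (svalP Z)).
have [R0 [r0 [e0 YR0]]] := coker _ _ _ _ _ _ (- hom0 f) ip0 (proj2 (svalP A')) (proj2 (svalP Z)).
rewrite -k1 in e1; rewrite -k0 in e0.
have [C [q kq]] := @inflation_coker A (biprod B A') k _ _ _ _ e1 e0 YR1 YR0.
exists C, (q \oc bi_inr B A'), (q \oc bi_inl B A'); split.
  exact: cokernel_pushout (biprod_is_biproduct B A') (confl_is_cokernel kq).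
move: kq => [kq1 kq0]; change (short_exact (hom1 k) (hom1 q)) in kq1.
change (short_exact (hom0 k) (hom0 q)) in kq0; rewrite k1 in kq1; rewrite k0 in kq0.
have [z1 z1E] := short_exact_pushout ip1 kq1.
have [z0 z0E] := short_exact_pushout ip0 kq0.
exact: (@inflation_coker A' C (q \oc bi_inr B A') _ _ _ _ z1E z0E
  (proj1 (svalP Z)) (proj2 (svalP Z))).
Qed.

Lemma sub_pullback (B Z Z' : E) (p : hom B Z) (f : hom Z' Z) :
  deflation p -> exists (B' : E) (p' : hom B' Z') (f' : hom B' B),
    is_pullback p f p' f' /\ deflation p'.
Proof.
move=> [A [i [ip1 ip0]]].
pose d : hom (biprod B Z') Z := p \oc bi_fst B Z' - f \oc bi_snd B Z'.
have d1 : hom1 d = lhom_copair (hom1 p) (- hom1 f).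
  by apply: lhom_ext => x; rewrite !homE biE biE.
have d0 : hom0 d = lhom_copair (hom0 p) (- hom0 f).
  by apply: lhom_ext => x; rewrite !homE biE biE.
have ker U V V' W (u : lhom U V) (v : lhom V W) (g : lhom V' W) :
    short_exact u v -> Y U -> Y V' ->
    exists R (r : lhom R (V * V')%type), short_exact r (lhom_copair v g) /\ Y R.
  move=> uv YU YV'; have [_ _ sv] := uv.
  have sd : surj (lhom_copair v g).
    by move=> x; have [y vy] := sv x; exists (y, 0); rewrite /= lhom0 addr0.
  have [R [r rE]] := short_exact_ker sd; have [z zE] := short_exact_pullback uv rE.
  by exists R, r; split=> //; exact: fc_ext FY _ _ _ _ _ zE YU YV'.
have [R1 [r1 [e1 YR1]]] := ker _ _ _ _ _ _ (- hom1 f) ip1 (proj1 (svalP A)) (proj1 (svalP Z')).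
have [R0 [r0 [e0 YR0]]] := ker _ _ _ _ _ _ (- hom0 f) ip0 (proj2 (svalP A)) (proj2 (svalP Z')).
rewrite -d1 in e1; rewrite -d0 in e0.
have [K [k kd]] := @deflation_ker (biprod B Z') Z d _ _ _ _ e1 e0 YR1 YR0.
exists K, (bi_snd B Z' \oc k), (bi_fst B Z' \oc k); split.
  exact: kernel_pullback (biprod_is_biproduct B Z') (confl_is_kernel kd).
move: kd => [kd1 kd0]; change (short_exact (hom1 k) (hom1 d)) in kd1.
change (short_exact (hom0 k) (hom0 d)) in kd0; rewrite d1 in kd1; rewrite d0 in kd0.
have [z1 z1E] := short_exact_pullback ip1 kd1.
have [z0 z0E] := short_exact_pullback ip0 kd0.
exact: (@deflation_ker K Z' (bi_snd B Z' \oc k) _ _ _ _ z1E z0E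
  (proj1 (svalP A)) (proj2 (svalP A))).
Qed.

Lemma sub_is_exact : is_exact E.
Proof.
split.
- split; first by exists zero_obj; apply: hom_ext => x; rewrite [LHS]row_zero [RHS]row_zero.
  move=> A B; exists (biprod A B), (bi_inl A B), (bi_inr A B), (bi_fst A B), (bi_snd A B).
  exact: biprod_is_biproduct.
- exact: confl_is_kernel.
- exact: confl_is_cokernel.
- move=> A B C A' B' C' i p i' p' a b c /iso_bij[a1 a0] /iso_bij[b1 b0] /iso_bij[c1 c0].
  move=> ia pb [ip1 ip0]; split.
    apply: (short_exact_iso (bij_surj a1) b1 c1 _ _ ip1) => x.
      exact: (congr1 (fun h => hom1 h x) ia).
    exact: (congr1 (fun h => hom1 h x) pb).
  apply: (short_exact_iso (bij_surj a0) b0 c0 _ _ ip0) => x.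
    exact: (congr1 (fun h => hom0 h x) ia).
  exact: (congr1 (fun h => hom0 h x) pb).
- by move=> A; exists zero_obj, 0; split; exact: short_exact_id_r row_zero.
- by move=> A; exists zero_obj, 0; split; exact: short_exact_id_l row_zero.
- exact: sub_inflation_comp.
- exact: sub_deflation_comp.
- exact: sub_pushout.
- exact: sub_pullback.
Qed.

End Factorizations.

(** * Contractible factorizations and the Frobenius property *)

Section Cylinders.
Variables (S : comNzRingType) (w : S) (X : lmodType S -> Prop).
Hypothesis XP : forall M, fg_projective M -> X M.

Lemma fg_projective_row n : fg_projective ('rV[S]_n : lmodType S).
Proof. by split; [exact: fin_gen_row|exact: projective_row]. Qed.

Lemma fg_projective_rows n m : fg_projective ('rV[S]_n * 'rV[S]_m : lmodType S)%type.
Proof.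
exact: fg_projective_ext (short_exact_prod _ _) (fg_projective_row n) (fg_projective_row m).
Qed.

Definition homothety (M : lmodType S) : lhom M M := w *: lhom_id M.

Lemma homothetyE (M : lmodType S) (x : M) : homothety M x = w *: x.
Proof. by []. Qed.

Definition cyl1 n m : lhom ('rV[S]_n * 'rV[S]_m)%type ('rV[S]_n * 'rV[S]_m)%type :=
  lhom_prod (lhom_id _) (homothety _).

Definition cyl0 n m : lhom ('rV[S]_n * 'rV[S]_m)%type ('rV[S]_n * 'rV[S]_m)%type :=
  lhom_prod (homothety _) (lhom_id _).

Lemma cyl1E n m x : cyl1 n m x = (x.1, w *: x.2).
Proof. by rewrite /cyl1 lhom_prodE homothetyE. Qed.

Lemma cyl0E n m x : cyl0 n m x = (w *: x.1, x.2).
Proof. by rewrite /cyl0 lhom_prodE homothetyE. Qed.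

Lemma cyl10 n m x : cyl1 n m (cyl0 n m x) = w *: x.
Proof. by rewrite cyl1E cyl0E. Qed.

Lemma cyl01 n m x : cyl0 n m (cyl1 n m x) = w *: x.
Proof. by rewrite cyl0E cyl1E. Qed.

(* The sum of the contractible factorizations (1, w) and (w, 1), of ranks n and m. *)
Definition cyl n m : MF w X :=
  MatFact (XP (fg_projective_rows n m)) (XP (fg_projective_rows n m))
    (@cyl10 n m) (@cyl01 n m).

Definition cyl_retract (A : MF w X) : Prop :=
  exists (n m : nat) (s : hom A (cyl n m)) (r : hom (cyl n m) A), r \oc s = idm A.

Lemma cyl_retract_fg_projective A : cyl_retract A ->
  fg_projective (mf1 A) /\ fg_projective (mf0 A).
Proof.
move=> [n [m [s [r rs]]]]; have [fF PF] := fg_projective_rows n m.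
have rs1 x : phi1 r (phi1 s x) = x by exact: (congr1 (fun h : mf_hom A A => phi1 h x) rs).
have rs0 x : phi0 r (phi0 s x) = x by exact: (congr1 (fun h : mf_hom A A => phi0 h x) rs).
split; split.
- by apply: (fin_gen_surj (p := phi1 r)) fF => x; exists (phi1 s x).
- exact: projective_retract rs1 PF.
- by apply: (fin_gen_surj (p := phi0 r)) fF => x; exists (phi0 s x).
- exact: projective_retract rs0 PF.
Qed.

Variable Y : lmodType S -> Prop.
Hypotheses (YX : forall M, Y M -> X M) (FY : frobenius_class Y).

Local Notation E := (full_subcategory (@mf_in S w X Y)).

Definition cyl_obj n m : E :=
  exist _ (cyl n m) (conj (fc_proj FY (fg_projective_rows n m))
                          (fc_proj FY (fg_projective_rows n m))).

Section CylMaps.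
Variables (A : E) (n m : nat).

Section Out.
Variables (p1 : lhom 'rV[S]_n (mf1 (sval A))) (p0 : lhom 'rV[S]_m (mf0 (sval A))).

Fact cyl_out_commutes1 x : mf_g1 (sval A) (lhom_copair p1 (lhom_comp (mf_g0 (sval A)) p0) x)
  = lhom_copair (lhom_comp (mf_g1 (sval A)) p1) p0 (cyl1 n m x).
Proof. by rewrite cyl1E /= lhomD mf_eq1 lhomZ. Qed.

Fact cyl_out_commutes0 x : mf_g0 (sval A) (lhom_copair (lhom_comp (mf_g1 (sval A)) p1) p0 x)
  = lhom_copair p1 (lhom_comp (mf_g0 (sval A)) p0) (cyl0 n m x).
Proof. by rewrite cyl0E /= lhomD mf_eq0 lhomZ. Qed.

(** The summand (1, w) is free on its degree 1 part and (w, 1) on its degree 0 part. So [p1] and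
    [p0] can be prescribed at will, and by [cyl_out_eq] every map out arises in this way. *)
Definition cyl_out : hom (cyl_obj n m) A :=
  @mk_hom S w X Y (cyl_obj n m) A _ _ cyl_out_commutes1 cyl_out_commutes0.

Lemma cyl_out1 x : hom1 cyl_out x = p1 x.1 + mf_g0 (sval A) (p0 x.2).
Proof. by []. Qed.

Lemma cyl_out0 x : hom0 cyl_out x = mf_g1 (sval A) (p1 x.1) + p0 x.2.
Proof. by []. Qed.

End Out.

Section In.
Variables (j0 : lhom (mf0 (sval A)) 'rV[S]_n) (j1 : lhom (mf1 (sval A)) 'rV[S]_m).

Fact cyl_in_commutes1 x : cyl1 n m (lhom_pair (lhom_comp j0 (mf_g1 (sval A))) j1 x)
  = lhom_pair j0 (lhom_comp j1 (mf_g0 (sval A))) (mf_g1 (sval A) x).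
Proof. by rewrite cyl1E; congr pair; rewrite /= mf_eq0 lhomZ. Qed.

Fact cyl_in_commutes0 x : cyl0 n m (lhom_pair j0 (lhom_comp j1 (mf_g0 (sval A))) x)
  = lhom_pair (lhom_comp j0 (mf_g1 (sval A))) j1 (mf_g0 (sval A) x).
Proof. by rewrite cyl0E; congr pair; rewrite /= mf_eq1 lhomZ. Qed.

(** Dually (1, w) is cofree on degree 0 and (w, 1) on degree 1; this is why [j0] takes values in the
    first summand, of rank n, and [j1] in the second. *)
Definition cyl_in : hom A (cyl_obj n m) :=
  @mk_hom S w X Y A (cyl_obj n m) _ _ cyl_in_commutes1 cyl_in_commutes0.

Lemma cyl_in1 x : hom1 cyl_in x = (j0 (mf_g1 (sval A) x), j1 x).
Proof. by []. Qed.

Lemma cyl_in0 x : hom0 cyl_in x = (j0 x, j1 (mf_g0 (sval A) x)).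
Proof. by []. Qed.

End In.

Lemma cyl_out_eq (f : hom (cyl_obj n m) A) :
  f = cyl_out (lhom_comp (hom1 f) (lhom_inl _ _)) (lhom_comp (hom0 f) (lhom_inr _ _)).
Proof.
apply: hom_ext => x; [rewrite cyl_out1|rewrite cyl_out0].
  rewrite lhomE homg0 -lhomD; congr (hom1 f _).
  by rewrite [mf_g0 _ _]cyl0E; case: x => a b; congr pair; rewrite /= ?scaler0 ?addr0 ?add0r.
rewrite lhomE homg1 -lhomD; congr (hom0 f _).
by rewrite [mf_g1 _ _]cyl1E; case: x => a b; congr pair; rewrite /= ?scaler0 ?addr0 ?add0r.
Qed.

Lemma cyl_in_eq (f : hom A (cyl_obj n m)) :
  f = cyl_in (lhom_comp (lhom_fst _ _) (hom0 f)) (lhom_comp (lhom_snd _ _) (hom1 f)).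
Proof.
apply: hom_ext => x; [rewrite cyl_in1|rewrite cyl_in0].
  by rewrite !lhomE -homg1 [mf_g1 _ _]cyl1E lhom_fstE lhom_sndE; case: (hom1 f x).
by rewrite !lhomE -homg0 [mf_g0 _ _]cyl0E lhom_fstE lhom_sndE; case: (hom0 f x).
Qed.

End CylMaps.

Lemma cyl_projective n m : projective_obj (cyl_obj n m).
Proof.
move=> B C p f [K [k [kp1 kp0]]]; have [_ _ s1] := kp1; have [_ _ s0] := kp0.
have [p1 p1E] := @projective_row S n _ _ (hom1 p) (lhom_comp (hom1 f) (lhom_inl _ _)) s1.
have [p0 p0E] := @projective_row S m _ _ (hom0 p) (lhom_comp (hom0 f) (lhom_inr _ _)) s0.
exists (cyl_out p1 p0); rewrite [RHS]cyl_out_eq.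
apply: hom_ext => x; [rewrite hom1M 2!cyl_out1|rewrite hom0M 2!cyl_out0].
  by rewrite lhomD -homg0 p1E p0E.
by rewrite lhomD -homg1 p1E p0E.
Qed.

(** Only the two maps into free modules have to be extended, which is possible because Ext^1(-, S)
    vanishes on the components of the cokernel of [i]. *)
Lemma cyl_injective n m : injective_obj (cyl_obj n m).
Proof.
move=> B C i f [Q [q [iq1 iq0]]].
have [j0 j0E] := ext1_extend_row (lhom_comp (lhom_fst _ _) (hom0 f)) iq0
  (fc_ext1 FY (proj2 (svalP Q))).
have [j1 j1E] := ext1_extend_row (lhom_comp (lhom_snd _ _) (hom1 f)) iq1
  (fc_ext1 FY (proj1 (svalP Q))).
exists (cyl_in j0 j1); rewrite [RHS]cyl_in_eq.
apply: hom_ext => x; [rewrite hom1M 2!cyl_in1|rewrite hom0M 2!cyl_in0].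
  by rewrite [mf_g1 _ _]homg1 [j0 _]j0E [j1 _]j1E.
by rewrite [mf_g0 _ _]homg0 [j0 _]j0E [j1 _]j1E.
Qed.

(** Free covers of the two components already make [cyl_out] onto in both degrees; its kernels lie
    in [Y] as kernels of covers by projectives. *)
Lemma cyl_deflation (A : E) : exists n m (p : hom (cyl_obj n m) A), deflation p.
Proof.
have [Y1 Y0] := svalP A.
have /fin_genP[n [p1 s1]] := fc_fg FY Y1; have /fin_genP[m [p0 s0]] := fc_fg FY Y0.
have FF := fg_projective_rows n m.
have S1 : surj (hom1 (cyl_out p1 p0)).
  by move=> y; have [x <-] := s1 y; exists (x, 0); rewrite cyl_out1 !lhom0 addr0.
have S0 : surj (hom0 (cyl_out p1 p0)).
  by move=> y; have [x <-] := s0 y; exists (0, x); rewrite cyl_out0 !lhom0 add0r.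
have [K1 [k1 e1]] := short_exact_ker S1; have [K0 [k0 e0]] := short_exact_ker S0.
have [K [k kE]] := deflation_ker YX e1 e0 (fc_ker FY e1 FF Y1) (fc_ker FY e0 FF Y0).
by exists n, m, (cyl_out p1 p0), K, k.
Qed.

Lemma cyl_inflation (A : E) : exists n m (i : hom A (cyl_obj n m)), inflation i.
Proof.
have [Y1 Y0] := svalP A.
have [n [j0 [i0 d0]]] := fc_embed FY Y0; have [m [j1 [i1 d1]]] := fc_embed FY Y1.
have FF := fg_projective_rows n m.
have I1 : injective (hom1 (cyl_in j0 j1)) by move=> x y; rewrite !cyl_in1 => -[_ /i1].
have I0 : injective (hom0 (cyl_in j0 j1)) by move=> x y; rewrite !cyl_in0 => -[/i0].
have D1 : dual_surj (hom1 (cyl_in j0 j1)).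
  move=> f; have [g gE] := d1 f; exists (lhom_comp g (lhom_snd _ _)) => x.
  by rewrite lhomE lhom_sndE cyl_in1 gE.
have D0 : dual_surj (hom0 (cyl_in j0 j1)).
  move=> f; have [g gE] := d0 f; exists (lhom_comp g (lhom_fst _ _)) => x.
  by rewrite lhomE lhom_fstE cyl_in0 gE.
have [K1 [k1 e1]] := short_exact_coker I1; have [K0 [k0 e0]] := short_exact_coker I0.
have [K [k kE]] := inflation_coker YX e1 e0 (fc_coker FY e1 FF D1 Y1) (fc_coker FY e0 FF D0 Y0).
by exists n, m, (cyl_in j0 j1), K, k.
Qed.

Lemma sub_projectiveP (A : E) : projective_obj A <-> cyl_retract (sval A).
Proof.
split=> [PA|[n [m [s [r rs]]]]].
  have [n [m [p dp]]] := cyl_deflation A; have [s ps] := PA _ _ p (idm A) dp.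
  by exists n, m, s, p.
exact: (@projective_retract_obj E A (cyl_obj n m) s r rs (@cyl_projective n m)).
Qed.

Lemma sub_injectiveP (A : E) : injective_obj A <-> cyl_retract (sval A).
Proof.
split=> [PA|[n [m [s [r rs]]]]].
  have [n [m [i di]]] := cyl_inflation A; have [r ri] := PA _ _ i (idm A) di.
  by exists n, m, i, r.
exact: (@injective_retract_obj E A (cyl_obj n m) s r rs (@cyl_injective n m)).
Qed.

Lemma sub_is_frobenius : is_frobenius E.
Proof.
split; first exact: sub_is_exact YX FY.
- move=> A; have [n [m [p dp]]] := cyl_deflation A.
  by exists (cyl_obj n m), p; split=> //; exact: cyl_projective.
- move=> A; have [n [m [i di]]] := cyl_inflation A.
  by exists (cyl_obj n m), i; split=> //; exact: cyl_injective.
- by move=> A; rewrite sub_projectiveP sub_injectiveP.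
Qed.

End Cylinders.

(** * Stable categories *)

Section TotalSubcategory.
Variables (E : exact_data) (D : E -> Prop) (DT : forall A, D A).

Local Notation F := (full_subcategory D).

(** When D holds everywhere, [F] has the morphisms and conflations of [E], but its objects are
    pairs, so the two are not convertible. The lemmas of this section carry the Frobenius property
    across. *)
Definition total_obj (A : E) : F := exist D A (DT A).

Lemma total_inflation (A B : E) (i : hom A B) :
  inflation i <-> @inflation F (total_obj A) (total_obj B) i.
Proof.
split=> -[C [p ip]]; first by exists (total_obj C), p.
by exists (sval C), p.
Qed.

Lemma total_deflation (A B : E) (p : hom A B) :
  deflation p <-> @deflation F (total_obj A) (total_obj B) p.
Proof.
split=> -[C [i ip]]; first by exists (total_obj C), i.
by exists (sval C), i.
Qed.

Lemma total_projective (A : E) : projective_obj A <-> @projective_obj F (total_obj A).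
Proof.
split=> PA B C p f dp.
  by apply: (PA (sval B) (sval C) p f); case: dp => K [k kp]; exists (sval K), k.
exact: (PA (total_obj B) (total_obj C) p f (proj1 (total_deflation p) dp)).
Qed.

Lemma total_injective (A : E) : injective_obj A <-> @injective_obj F (total_obj A).
Proof.
split=> PA B C i f di.
  by apply: (PA (sval B) (sval C) i f); case: di => K [k ik]; exists (sval K), k.
exact: (PA (total_obj B) (total_obj C) i f (proj1 (total_inflation i) di)).
Qed.

Lemma total_is_exact : is_exact F -> is_exact E.
Proof.
move=> HF; split.
- split.
    by have [Z e] := has_zero (exact_additive HF); exists (sval Z).
  move=> A B; have [C [i1 [i2 [p1 [p2 b]]]]] :=
    has_biproducts (exact_additive HF) (total_obj A) (total_obj B).
  by exists (sval C), i1, i2, p1, p2; case: b.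
- move=> A B C i p ip.
  have [e u] := @confl_kernel F HF (total_obj A) (total_obj B) (total_obj C) i p ip.
  by split=> // T; exact: (u (total_obj T)).
- move=> A B C i p ip.
  have [e u] := @confl_cokernel F HF (total_obj A) (total_obj B) (total_obj C) i p ip.
  by split=> // T; exact: (u (total_obj T)).
- move=> A B C A' B' C' i p i' p' a b c ia ib ic.
  exact: (@confl_iso F HF (total_obj A) (total_obj B) (total_obj C)
    (total_obj A') (total_obj B') (total_obj C') i p i' p' a b c ia ib ic).
- by move=> A; apply/total_inflation; exact: (inflation_id HF (total_obj A)).
- by move=> A; apply/total_deflation; exact: (deflation_id HF (total_obj A)).
- move=> A B C j i /total_inflation ij /total_inflation ii; apply/total_inflation.
  exact: (inflation_comp HF ij ii).
- move=> A B C q p /total_deflation dq /total_deflation dp; apply/total_deflation.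
  exact: (deflation_comp HF dq dp).
- move=> A B A' i f /total_inflation ii.
  have [B' [i' [f' [[e u] ii']]]] :=
    @inflation_pushout F HF (total_obj A) (total_obj B) (total_obj A') i f ii.
  exists (sval B'), i', f'; split; last by case: ii' => K [k ik]; exists (sval K), k.
  by split=> // T; exact: (u (total_obj T)).
- move=> B C C' p f /total_deflation dp.
  have [B' [p' [f' [[e u] dp']]]] :=
    @deflation_pullback F HF (total_obj B) (total_obj C) (total_obj C') p f dp.
  exists (sval B'), p', f'; split; last by case: dp' => K [k kp]; exists (sval K), k.
  by split=> // T; exact: (u (total_obj T)).
Qed.

Lemma total_is_frobenius : is_frobenius F -> is_frobenius E.
Proof.
move=> HF; split; first exact: total_is_exact (frobenius_exact HF).
- move=> A; have [[P DP] [p [PP [K [k kp]]]]] := enough_projectives HF (total_obj A).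
  exists P, p; split; last by exists (sval K), k.
  (* P comes with its own proof of D, identified with [DT P] by proof irrelevance. *)
  by apply/total_projective; rewrite /total_obj (Prop_irrelevance (DT P) DP).
- move=> A; have [[P DP] [p [PP [K [k kp]]]]] := enough_injectives HF (total_obj A).
  exists P, p; split; last by exists (sval K), k.
  by apply/total_injective; rewrite /total_obj (Prop_irrelevance (DT P) DP).
- by move=> A; rewrite total_projective total_injective; exact: projective_injective.
Qed.

End TotalSubcategory.

(** * Maps between arbitrary cosyzygies *)

Section Cosyzygies.
Variables (E : exact_data) (HE : is_frobenius E).

Let exE := frobenius_exact HE.

Lemma cosyzygy_map (X I Z X' I' Z' : E) (i : hom X I) (p : hom I Z)
    (i' : hom X' I') (p' : hom I' Z') (f : hom X X') :
  confl i p -> confl i' p' -> injective_obj I' ->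
  exists (t : hom Z Z') (e : hom I I'), e \oc i = i' \oc f /\ t \oc p = p' \oc e.
Proof.
move=> ip ip' inj; have infi : inflation i by exists Z, p.
have [e ee] := inj _ _ i (i' \oc f) infi.
have [p0 _] := confl_kernel exE ip'; have [_ c] := confl_cokernel exE ip.
have [|t [te _]] := c _ (p' \oc e); first by rewrite -compmA ee compmA p0 compm0l.
by exists t, e.
Qed.

(** As [e] kills [i], it equals k p for some k, and t = p' k factors through I', which is injective
    and so projective. Applied to a difference of lifts, it gives uniqueness of induced maps in the
    stable category. *)
Lemma cosyzygy_map_null (X I Z X' I' Z' : E) (i : hom X I) (p : hom I Z)
    (i' : hom X' I') (p' : hom I' Z') (t : hom Z Z') (e : hom I I') :
  confl i p -> confl i' p' -> injective_obj I' ->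
  e \oc i = 0 -> t \oc p = p' \oc e -> factors_projective t.
Proof.
move=> ip ip' inj e0 te; have [_ c] := confl_cokernel exE ip.
have [k [ke _]] := c _ e e0.
exists I', p', k; split; first exact/(projective_injective HE).
have [|h [_ hU]] := c _ (t \oc p).
  by have [p0 _] := confl_kernel exE ip; rewrite -compmA p0 compm0r.
by rewrite -(hU t) //; apply: hU; rewrite -compmA ke te.
Qed.

End Cosyzygies.

Section AdditiveFunctors.
Variables (C C' : preadditive) (G : additive_functor C C').

Lemma fmap_iso (A B : C) (f : hom A B) : is_iso f -> is_iso (fmap G f).
Proof. by move=> [g [gf fg]]; exists (fmap G g); rewrite -!fmap_comp gf fg !fmap_id. Qed.

Lemma fmap0 (A B : C) : fmap G (0 : hom A B) = 0.
Proof. by apply: (addrI (fmap G 0)); rewrite -fmapD !addr0. Qed.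

Lemma fmapN (A B : C) (f : hom A B) : fmap G (- f) = - fmap G f.
Proof. by apply: (addrI (fmap G f)); rewrite -fmapD !subrr fmap0. Qed.

End AdditiveFunctors.

(** * The stable functor induced by the inclusion *)

Section StableInclusion.
Variables (E : exact_data) (D : E -> Prop).
Local Notation F := (full_subcategory D).
Hypotheses (HE : is_frobenius E) (HF : is_frobenius F) (SP : same_projectives D).

Lemma sub_projective (A : F) : projective_obj A <-> @projective_obj E (sval A).
Proof.
case: A => A DA; split=> [PA|/SP[DA' PA]]; first by apply/SP; exists DA.
by rewrite (Prop_irrelevance DA DA').
Qed.

(** A projective of the large category lies in the subcategory, so a factorization through it
    already lives there. This gives both well-definedness and faithfulness on stable classes. *)
Lemma sub_factors_projective (A B : F) (f : hom A B) :
  factors_projective f <-> @factors_projective E (sval A) (sval B) f.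
Proof.
split=> [[P [b [a [PP ->]]]]|[P [b [a [/SP[DP PP] ->]]]]].
  by exists (sval P), b, a; split=> //; exact/sub_projective.
by exists (exist D P DP), b, a.
Qed.

Local Notation SF := (stable_preadditive HF).
Local Notation SE := (stable_preadditive HE).

Definition incl_obj (A : SF) : SE := sval (A : F).

(** [stable_class] retyped as a morphism of the stable category, so that composition is elaborated
    there. *)
Definition class_sup (A B : E) (f : hom A B) : @hom SE A B := stable_class HE f.
Definition class_sub (A B : F) (f : hom A B) : @hom SF A B := stable_class HF f.

Lemma class_supP (A B : E) (f g : hom A B) :
  class_sup f = class_sup g <-> factors_projective (f - g).
Proof. exact: stable_classP. Qed.

Lemma class_subP (A B : F) (f g : hom A B) :
  class_sub f = class_sub g <-> factors_projective (f - g).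
Proof. exact: stable_classP. Qed.

Lemma class_supM (A B C : E) (g : hom B C) (f : hom A B) :
  class_sup (g \oc f) = class_sup g \oc class_sup f.
Proof. by rewrite /compm /= stable_classM. Qed.

Lemma class_subM (A B C : F) (g : hom B C) (f : hom A B) :
  class_sub (g \oc f) = class_sub g \oc class_sub f.
Proof. by rewrite /compm /= stable_classM. Qed.

Lemma class_supD (A B : E) (f g : hom A B) : class_sup (f + g) = class_sup f + class_sup g.
Proof. exact: stable_classD. Qed.

Lemma class_subD (A B : F) (f g : hom A B) : class_sub (f + g) = class_sub f + class_sub g.
Proof. exact: stable_classD. Qed.

Lemma class_sub_repr (A B : F) (f : @hom SF A B) : exists g : hom A B, f = class_sub g.
Proof. by exists (repr (f : stable_hom HF A B)); rewrite /class_sub stable_classK. Qed.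

Definition incl_map (A B : SF) (f : @hom SF A B) : @hom SE (incl_obj A) (incl_obj B) :=
  @class_sup (sval (A : F)) (sval (B : F)) (repr (f : stable_hom HF A B)).

Lemma incl_mapE (A B : F) (f : hom A B) :
  incl_map (class_sub f) = @class_sup (sval A) (sval B) f.
Proof.
apply/class_supP; apply/(@sub_factors_projective A B); apply/class_subP.
exact: stable_classK.
Qed.

Fact incl_map_id (A : SF) : incl_map (idm A) = idm (incl_obj A).
Proof. exact: incl_mapE. Qed.

Fact incl_map_comp (A B C : SF) (g : hom B C) (f : hom A B) :
  incl_map (g \oc f) = incl_map g \oc incl_map f.
Proof.
have [g' ->] := class_sub_repr g; have [f' ->] := class_sub_repr f.
by rewrite -class_subM !incl_mapE -class_supM.
Qed.

Fact incl_mapD (A B : SF) (f g : hom A B) : incl_map (f + g) = incl_map f + incl_map g.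
Proof.
have [g' ->] := class_sub_repr g; have [f' ->] := class_sub_repr f.
by rewrite -class_subD !incl_mapE -class_supD.
Qed.

Definition stable_incl : additive_functor (stable HF) (stable HE) :=
  @AdditiveFunctor (stable HF) (stable HE) incl_obj incl_map
    incl_map_id incl_map_comp incl_mapD.

Lemma stable_incl_fully_faithful : fully_faithful stable_incl.
Proof.
move=> A B.
exists (fun g => @class_sub A B (repr (g : stable_hom HE (sval (A : F)) (sval (B : F))))) => f.
  have [f' ->] := class_sub_repr f; rewrite [fmap _ _]incl_mapE.
  apply/class_subP; apply/(@sub_factors_projective A B); apply/class_supP; exact: stable_classK.
rewrite [LHS]incl_mapE; exact: stable_classK.
Qed.

Lemma cosyzI_injective_sup (A : F) : @injective_obj E (sval (cosyzI HF A)).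
Proof.
apply/(projective_injective HE); apply/sub_projective; apply/(projective_injective HF).
exact: cosyzI_injective.
Qed.

(** Compares, over the identity of A, the cosyzygy chosen in the subcategory with the one chosen in
    the large category. *)
Lemma eta_exists (A : F) :
  exists (t : @hom E (sval (Sigma HF A)) (Sigma HE (sval A)))
    (e : @hom E (sval (cosyzI HF A)) (cosyzI HE (sval A))),
    e \oc (iota HF A : @hom E _ _) = iota HE (sval A) /\
    t \oc (piS HF A : @hom E _ _) = piS HE (sval A) \oc e.
Proof.
have [t [e [e1 e2]]] := cosyzygy_map HE (idm (sval A))
  (iota_piS HF A : @confl E (sval A) (sval (cosyzI HF A)) (sval (Sigma HF A)) _ _)
  (iota_piS HE (sval A)) (@cosyzI_injective E HE (sval A)).
by exists t, e; rewrite e1 compm1.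
Qed.

Definition eta0 (A : F) : @hom E (sval (Sigma HF A)) (Sigma HE (sval A)) :=
  sval (cid (eta_exists A)).

Lemma eta0P (A : F) : exists e : @hom E (sval (cosyzI HF A)) (cosyzI HE (sval A)),
  e \oc (iota HF A : @hom E _ _) = iota HE (sval A) /\
  eta0 A \oc (piS HF A : @hom E _ _) = piS HE (sval A) \oc e.
Proof. exact: svalP (cid (eta_exists A)). Qed.

Definition eta (A : stable HF) :
    hom (stable_incl (shift (stable HF) A)) (shift (stable HE) (stable_incl A)) :=
  @class_sup (sval (Sigma HF A)) (Sigma HE (sval (A : F))) (eta0 A).

Lemma eta_iso (A : stable HF) : is_iso (eta A).
Proof.
have [e [e1 e2]] := eta0P A.
have cF : @confl E (sval (A : F)) (sval (cosyzI HF A)) (sval (Sigma HF A))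
  (iota HF A) (piS HF A) := iota_piS HF A.
have cE := iota_piS HE (sval (A : F)).
have injF := @cosyzI_injective_sup A.
have injE := @cosyzI_injective E HE (sval (A : F)).
have [t [d [d1 d2]]] := cosyzygy_map HE (idm (sval (A : F))) cE cF injF.
rewrite compm1 in d1.
exists (class_sup t); split.
  rewrite -[LHS]class_supM; apply/class_supP.
  (* Both d e and the identity restrict to [iota] on A, so their difference kills it. *)
  apply: (@cosyzygy_map_null E HE _ _ _ _ _ _ _ _ _ _ _ (d \oc e - idm _) cF cF injF).
    by rewrite compmBl -compmA e1 d1 comp1m subrr.
  by rewrite compmBl compmBr -compmA e2 !compmA d2 comp1m compm1.
rewrite -[LHS]class_supM; apply/class_supP.
apply: (@cosyzygy_map_null E HE _ _ _ _ _ _ _ _ _ _ _ (e \oc d - idm _) cE cE injE).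
  by rewrite compmBl -compmA d1 e1 comp1m subrr.
by rewrite compmBl compmBr -compmA d2 !compmA e2 comp1m compm1.
Qed.

Lemma eta_natural (A B : stable HF) (f : hom A B) :
  eta B \oc fmap stable_incl (fmap (shift (stable HF)) f) =
  fmap (shift (stable HE)) (fmap stable_incl f) \oc eta A.
Proof.
have [g ->] := class_sub_repr f.
have [sg [d [d1 d2]]] := Sigma_rel_exists HF g.
have -> : fmap (shift (stable HF)) (class_sub g) = class_sub sg by apply: Sigma_mapE; exists d.
have [sg' [d' [d1' d2']]] := @Sigma_rel_exists E HE (sval (A : F)) (sval (B : F)) g.
rewrite [fmap stable_incl (class_sub sg)]incl_mapE [fmap stable_incl (class_sub g)]incl_mapE.
have -> : fmap (shift (stable HE)) (class_sup g) = class_sup sg' by apply: Sigma_mapE; exists d'.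
rewrite -[LHS]class_supM -[RHS]class_supM; apply/class_supP.
have [e [e1 e2]] := eta0P A; have [e' [e1' e2']] := eta0P B.
have cF : @confl E (sval (A : F)) (sval (cosyzI HF A)) (sval (Sigma HF A))
  (iota HF A) (piS HF A) := iota_piS HF A.
have d1E : @compm E (sval (A : F)) (sval (cosyzI HF A)) (sval (cosyzI HF B)) d (iota HF A)
  = @compm E (sval (A : F)) (sval (B : F)) (sval (cosyzI HF B)) (iota HF B) g := d1.
have d2E : @compm E (sval (cosyzI HF A)) (sval (Sigma HF A)) (sval (Sigma HF B)) sg (piS HF A)
  = @compm E (sval (cosyzI HF A)) (sval (cosyzI HF B)) (sval (Sigma HF B)) (piS HF B) d := d2.
(* e' d and d' e both extend [iota] of B composed with g, so the maps they induce on cosyzygies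
   agree stably. *)
apply: (@cosyzygy_map_null E HE _ _ _ _ _ _ _ _ _ _ _ (e' \oc d - d' \oc e) cF
  (iota_piS HE (sval (B : F))) (@cosyzI_injective E HE (sval (B : F)))).
  by rewrite compmBl -!compmA e1 d1' d1E compmA e1' subrr.
by rewrite compmBl compmBr -!compmA e2 d2E !compmA e2' d2'.
Qed.

(** The conflation is kept; the extension of [iota] is pushed forward along the comparison e of
    injectives, so the connecting map is composed with [eta0] and its sign is unchanged. *)
Lemma stable_incl_standard (A B C : stable HF) (u : hom A B) (v : hom B C)
    (x : hom C (shift (stable HF) A)) :
  standard_triangle u v x ->
  @standard_triangle E HE (stable_incl A) (stable_incl B) (stable_incl C)
    (fmap stable_incl u) (fmap stable_incl v) (eta A \oc fmap stable_incl x).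
Proof.
move=> [i [p [a [b [ip ai bp [-> -> ->]]]]]].
have [e [e1 e2]] := eta0P A.
have bpE : @compm E (sval (B : F)) (sval (C : F)) (sval (Sigma HF A)) b p
  = @compm E (sval (B : F)) (sval (cosyzI HF A)) (sval (Sigma HF A)) (piS HF A) a := bp.
exists i, p, (e \oc a), (eta0 A \oc b); split=> //.
- by rewrite -e1 -compmA; congr (e \oc _).
- by rewrite -compmA bpE !compmA e2.
split; [exact: incl_mapE|exact: incl_mapE|].
rewrite fmapN compmNr [fmap _ _]incl_mapE; congr (- _); exact: esym (class_supM _ _).
Qed.

Lemma stable_incl_triangle : triangle_functor stable_incl.
Proof.
exists eta; split; [exact: eta_iso|exact: eta_natural|].
move=> A B C u v x [A' [B' [C' [u' [v' [x' [f [g [h [std isf isg ish [uf vg xh]]]]]]]]]]].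
exists (stable_incl A'), (stable_incl B'), (stable_incl C'), (fmap stable_incl u'),
  (fmap stable_incl v'), (eta A' \oc fmap stable_incl x'), (fmap stable_incl f),
  (fmap stable_incl g), (fmap stable_incl h).
split; try exact: fmap_iso; first exact: stable_incl_standard.
have G := fmap_comp stable_incl.
split.
- by rewrite -[LHS]G -[RHS]G uf.
- by rewrite -[LHS]G -[RHS]G vg.
- rewrite -[LHS]compmA -[X in _ \oc X]G xh [X in _ \oc X]G.
  by rewrite [LHS]compmA eta_natural -[LHS]compmA.
Qed.

End StableInclusion.

Theorem corollary3p11 (S : comNzRingType) (n : idealr S) (w : S)
    (S_noeth : noetherian S) (S_local : local_ring n)
    (w_in_n : w \in n) (w_reg : non_zerodivisor w) :
  exists (HG : is_frobenius (MF_G w))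
         (HP : is_frobenius_subcategory (in_MF_P (w := w))),
    same_projectives (in_MF_P (w := w)) /\
    exists F : additive_functor
                 (stable (frobenius_sub_frobenius HP : is_frobenius (MF_P w)))
                 (stable HG),
      triangle_functor F /\ fully_faithful F.
Proof.
have PG := fun M => @fg_projective_gp S S_noeth M.
have FG := frobenius_class_gp S_noeth; have FP := frobenius_class_fg_projective S_noeth.
have inG (A : MF_G w) : mf_in (@gorenstein_projective S) A by case: A.
have HG : is_frobenius (MF_G w).
  exact: (total_is_frobenius inG (sub_is_frobenius w PG (fun _ => id) FG)).
have HP : is_frobenius_subcategory (in_MF_P (w := w)).
  split; last exact: (sub_is_frobenius w PG PG FP).
  move=> A B C i p [ip1 ip0] [A1 A0] [C1 C0].
  by split; [exact: fg_projective_ext ip1 A1 C1|exact: fg_projective_ext ip0 A0 C0].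
exists HG, HP.
have SP : same_projectives (in_MF_P (w := w)).
  move=> A; split=> [/(total_projective inG)/(sub_projectiveP PG (fun _ => id) FG) cA|[DA]].
    (* Retracts of contractible factorizations have finitely generated projective entries, so a
       projective of the large category belongs to the subcategory. Both criteria use the same
       cylinders, built from [PG], and [cA] passes from one to the other as it stands. *)
    have DA := cyl_retract_fg_projective cA; exists DA.
    exact/(sub_projectiveP PG PG FP (exist _ A DA)).
  move=> /(sub_projectiveP PG PG FP) cA.
  exact/(total_projective inG)/(sub_projectiveP PG (fun _ => id) FG).
split=> //; exists (stable_incl HG (frobenius_sub_frobenius HP) SP); split.
  exact: stable_incl_triangle.
exact: stable_incl_fully_faithful.
Qed.
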